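(* Let $Q$ be a convex polygon with $n$ vertices and let $r>\varepsilon>0$. Then $\textsc{ConvexDecide}(Q,r,\varepsilon)$ returns the same answer as $\textsc{Decide}(Q,r,\varepsilon)$, and it runs in $O(n)$ time (in the real-RAM model).
   Context: $D_s(c)$ is the closed disk of radius $s$ around $c$, $D_s:=D_s(0)$, $X^C:=\mathbb{R}^2\setminus X$, $\mathrm{offset}(X,s):=X\oplus D_s$ (Minkowski sum), $\mathrm{inset}(X,s):=\mathrm{offset}(X^C,s)^C=\{x\mid D_s(x)\subseteq X\}$. $\textsc{Decide}(Q,r,\varepsilon)$: $Q_\varepsilon:=\mathrm{offset}(Q,\varepsilon)$, $\Pi:=\mathrm{inset}(Q_\varepsilon,r)$, $Q':=\mathrm{offset}(\Pi,r+\varepsilon)$; return YES if $Q\subseteq Q'$, else NO. $\textsc{ConvexDecide}(Q,r,\varepsilon)$: let $q_1,\ldots,q_n$ be the vertices of $Q$ in counterclockwise order and $K_i:=D_{r+\varepsilon}(q_i)$. (1) $Q_\varepsilon:=\mathrm{offset}(Q,\varepsilon)$; (2) $\Pi:=\mathrm{inset}(Q_\varepsilon,r)$; (3) return YES if $K_i\cap\Pi\neq\emptyset$ for all $i=1,\ldots,n$, otherwise NO. ($Q$ is given by its vertices in cyclic order.) *)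

(* Defs.v *)
From HB Require Import structures.
From mathcomp Require Import all_boot all_order all_algebra.
From mathcomp Require Import boolp classical_sets reals topology normedtype.
Set Implicit Arguments.
Unset Strict Implicit.
Unset Printing Implicit Defensive.
Import Order.TTheory GRing.Theory Num.Theory.
Import numFieldNormedType.Exports.
Local Open Scope classical_set_scope.
Local Open Scope ring_scope.

Section Plane.
Variable R : realType.
Local Notation point := (R * R)%type.

(* The library norm on R * R is the sup norm, whose disks are squares. *)
Definition enorm (x : point) : R := Num.sqrt (x.1 ^+ 2 + x.2 ^+ 2).

Definition disk (c : point) (s : R) : set point := [set x | enorm (x - c) <= s].

Definition offset (X : set point) (s : R) : set point :=
  [set x + d | x in X & d in disk 0 s].

Definition inset (X : set point) (s : R) : set point := ~` offset (~` X) s.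

Definition Decide (Q : set point) (r eps : R) : bool :=
  let Qeps := offset Q eps in
  let Pi := inset Qeps r in
  let Q' := offset Pi (r + eps) in
  `[< Q `<=` Q' >].

(* Twice the signed area of the triangle a b c: positive iff c lies strictly
   to the left of the line directed from a to b. *)
Definition orient (a b c : point) : R :=
  (b.1 - a.1) * (c.2 - a.2) - (b.2 - a.2) * (c.1 - a.1).

(* Vertices are indexed by 'I_n cyclically, ordS being the cyclic successor.
   Every vertex off the edge from q i to its successor lies strictly to the
   left of it: the q i are distinct, they are exactly the corners of their
   convex hull (no angle is flat), and they are listed counterclockwise. *)
Definition ccw_convex_polygon n (q : 'I_n -> point) : Prop :=
  (3 <= n)%N /\
  forall i k : 'I_n, k != i -> k != ordS i -> 0 < orient (q i) (q (ordS i)) (q k).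

(* The region spanned by the vertices, as their convex hull; it is empty
   when n = 0. *)
Definition polygon n (q : 'I_n -> point) : set point :=
  [set x | exists w : 'I_n -> R,
    [/\ forall i, 0 <= w i, \sum_i w i = 1 &
        x = (\sum_i w i * (q i).1, \sum_i w i * (q i).2)]].

Definition ConvexDecide n (q : 'I_n -> point) (r eps : R) : bool :=
  let Qeps := offset (polygon q) eps in
  let Pi := inset Qeps r in
  `[< forall i, disk (q i) (r + eps) `&` Pi !=set0 >].

Definition boundary (A : set point) : set point := closure A `\` interior A.

Definition segment (a b : point) : set point :=
  [set x | exists2 t : R, 0 <= t <= 1 &
    x = (a.1 + t * (b.1 - a.1), a.2 + t * (b.2 - a.2))].

(* The counterclockwise circular arc around c from a to b, for arcs that turn
   by less than a half circle. *)
Definition arc (c a b : point) : set point :=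
  [set x | [/\ enorm (x - c) = enorm (a - c),
               0 <= orient c a x & 0 <= orient c x b]].

(* The cyclic chain arc, segment, arc, segment, ... whose i-th arc goes
   around c i from a i to b i and is followed by the segment from b i to the
   start of the next arc. *)
Definition arc_chain m (c a b : 'I_m -> point) : set point :=
  \bigcup_(i in [set: 'I_m])
    (arc (c i) (a i) (b i) `|` segment (b i) (a (ordS i))).

(* A is the polygon with vertices v, in counterclockwise order.  As A may be
   empty, a point or a segment, m is arbitrary and orientations are weak. *)
Definition ccw_vertices m (v : 'I_m -> point) (A : set point) : Prop :=
  A = polygon v /\ forall i k : 'I_m, 0 <= orient (v i) (v (ordS i)) (v k).

End Plane.

(* The real RAM.  Memory consists of arrays of words (natural numbers) and
   arrays of real numbers, with indirect addressing.  Elementary operations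
   have unit cost: memory access, + and - on words, + - * / and square root
   on reals, exact comparisons.  There is no conversion from reals to words,
   and the only real constants are natural numbers.  Programs are structured
   (if and while), hence do no better than programs with arbitrary jumps.
   Word subtraction is truncated; division by zero and square roots of
   negative numbers return 0 (a program can test for them beforehand at
   constant cost). *)

Inductive wexp : Type :=
| WConst of nat
| WGet of nat & wexp (* array name, index *)
| WAdd of wexp & wexp
| WSub of wexp & wexp.

Inductive rexp : Type :=
| RConst of nat
| RGet of nat & wexp
| RAdd of rexp & rexp
| RSub of rexp & rexp
| RMul of rexp & rexp
| RDiv of rexp & rexp
| RSqrt of rexp.

Inductive bexp : Type :=
| BLtW of wexp & wexp
| BLtR of rexp & rexp
| BNot of bexp
| BAnd of bexp & bexp.

Inductive cmd : Type :=
| CSkip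
| CSetW of nat & wexp & wexp (* array name, index, value *)
| CSetR of nat & wexp & rexp
| CSeq of cmd & cmd
| CIf of bexp & cmd & cmd
| CWhile of bexp & cmd.

Fixpoint wcost (e : wexp) : nat :=
  match e with
  | WConst _ => 1
  | WGet _ e1 => (wcost e1).+1
  | WAdd e1 e2 | WSub e1 e2 => (wcost e1 + wcost e2).+1
  end%N.

Fixpoint rcost (e : rexp) : nat :=
  match e with
  | RConst _ => 1
  | RGet _ i => (wcost i).+1
  | RAdd e1 e2 | RSub e1 e2 | RMul e1 e2 | RDiv e1 e2 =>
      (rcost e1 + rcost e2).+1
  | RSqrt e1 => (rcost e1).+1
  end%N.

Fixpoint bcost (b : bexp) : nat :=
  match b with
  | BLtW e1 e2 => (wcost e1 + wcost e2).+1
  | BLtR e1 e2 => (rcost e1 + rcost e2).+1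
  | BNot b1 => (bcost b1).+1
  | BAnd b1 b2 => (bcost b1 + bcost b2).+1
  end%N.

Section Machine.
Variable R : realType.

Record state := State { wmem : nat -> nat -> nat; rmem : nat -> nat -> R }.

Definition upd (T : Type) (m : nat -> nat -> T) (a i : nat) (v : T) :
    nat -> nat -> T :=
  fun b j => if (b == a) && (j == i) then v else m b j.

Fixpoint weval (s : state) (e : wexp) : nat :=
  match e with
  | WConst k => k
  | WGet a i => wmem s a (weval s i)
  | WAdd e1 e2 => weval s e1 + weval s e2
  | WSub e1 e2 => weval s e1 - weval s e2
  end%N.

Fixpoint reval (s : state) (e : rexp) : R :=
  match e with
  | RConst k => k%:R
  | RGet a i => rmem s a (weval s i)
  | RAdd e1 e2 => reval s e1 + reval s e2
  | RSub e1 e2 => reval s e1 - reval s e2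
  | RMul e1 e2 => reval s e1 * reval s e2
  | RDiv e1 e2 => reval s e1 / reval s e2
  | RSqrt e1 => Num.sqrt (reval s e1)
  end.

Fixpoint beval (s : state) (b : bexp) : bool :=
  match b with
  | BLtW e1 e2 => (weval s e1 < weval s e2)%N
  | BLtR e1 e2 => reval s e1 < reval s e2
  | BNot b1 => ~~ beval s b1
  | BAnd b1 b2 => beval s b1 && beval s b2
  end.

(* exec c s t s': started in state s, the command c halts in state s' after
   exactly t elementary operations. *)
Inductive exec : cmd -> state -> nat -> state -> Prop :=
| exec_skip s : exec CSkip s 1 s
| exec_setw s a i e :
    exec (CSetW a i e) s (wcost i + wcost e).+1
      (State (upd (wmem s) a (weval s i) (weval s e)) (rmem s))
| exec_setr s a i e :
    exec (CSetR a i e) s (wcost i + rcost e).+1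
      (State (wmem s) (upd (rmem s) a (weval s i) (reval s e)))
| exec_seq c1 c2 s s1 s2 t1 t2 :
    exec c1 s t1 s1 -> exec c2 s1 t2 s2 -> exec (CSeq c1 c2) s (t1 + t2) s2
| exec_if b c1 c2 s s1 t :
    exec (if beval s b then c1 else c2) s t s1 ->
    exec (CIf b c1 c2) s (bcost b + t).+1 s1
| exec_while_false b c s :
    beval s b = false -> exec (CWhile b c) s (bcost b).+1 s
| exec_while_true b c s s1 s2 t1 t2 :
    beval s b = true -> exec c s t1 s1 -> exec (CWhile b c) s1 t2 s2 ->
    exec (CWhile b c) s (bcost b + t1 + t2).+1 s2.

(* A list of points occupies two consecutive real arrays, one for each
   coordinate. *)
Definition points (s : state) (a m : nat) : 'I_m -> R * R :=
  fun i => (rmem s a i, rmem s a.+1 i).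

(* Word array 0 has n in cell 0; real array 0 has r in cell 0 and eps in
   cell 1; real arrays 1 and 2 have the vertices; all the rest is 0. *)
Definition input n (q : 'I_n -> R * R) (r eps : R) : state :=
  State
    (fun a i => if (a == 0%N) && (i == 0%N) then n else 0%N)
    (fun a i =>
       match a with
       | 0%N => nth 0 [:: r; eps] i
       | 1%N => if insub i is Some j then (q j).1 else 0
       | 2%N => if insub i is Some j then (q j).2 else 0
       | _ => 0
       end).

(* Region stored as the arc chain forming its boundary, which determines it
   when it is compact and convex with interior points: number of arcs in
   cell 1 of word array 0; centers, start points and end points in the real
   arrays 3-4, 5-6 and 7-8. *)
Definition stores_offset (s : state) (A : set (R * R)) : Prop :=
  let m := wmem s 0 1 in
  boundary A = arc_chain (points s 3 (m := m)) (points s 5 (m := m))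
                         (points s 7 (m := m)).

(* Polygon stored as the list of its vertices: their number in cell 2 of word
   array 0, coordinates in the real arrays 9-10. *)
Definition stores_polygon (s : state) (A : set (R * R)) : Prop :=
  ccw_vertices (points s 9 (m := wmem s 0 2)) A.

(* The answer (1 for YES, 0 for NO) is in cell 3 of word array 0. *)
Definition answers (s : state) (b : bool) : Prop := wmem s 0 3 = nat_of_bool b.

(* The commands p1, p2, p3, run in sequence, perform the three steps of
   ConvexDecide on the given input, in at most T operations altogether: they
   construct Qeps, then Pi, and then return the answer. *)
Definition runs_ConvexDecide (p1 p2 p3 : cmd) n (q : 'I_n -> R * R)
    (r eps : R) (T : nat) : Prop :=
  let Qeps := offset (polygon q) eps in
  let Pi := inset Qeps r in
  exists s1 s2 s3 : state, exists t1 t2 t3 : nat,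
  [/\ exec p1 (input q r eps) t1 s1 /\ stores_offset s1 Qeps,
      exec p2 s1 t2 s2 /\ stores_polygon s2 Pi,
      exec p3 s2 t3 s3 /\ answers s3 (ConvexDecide q r eps) &
      (t1 + t2 + t3 <= T)%N].

End Machine.

(* Main.v *)
Require Import Defs.
From mathcomp Require Import all_boot all_order all_algebra.
From mathcomp Require Import boolp classical_sets reals topology normedtype ring lra zify.
Set Implicit Arguments.
Unset Strict Implicit.
Unset Printing Implicit Defensive.
Import Order.TTheory GRing.Theory Num.Theory.
Import numFieldNormedType.Exports.
Local Open Scope classical_set_scope.
Local Open Scope ring_scope.

(* [Decide] asks whether Q lies in the convex set offset(Pi, r + eps), and by
   convexity it suffices to look at the vertices of Q.

   For the running time put delta = r - eps.  The boundary of offset(Q, eps) is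
   read off the edges one by one.  Pi consists of the points at signed distance
   at least delta inside every edge line of Q, so it is obtained from Q by
   clipping with n half-planes.  They come sorted by direction, hence the next
   half-plane always cuts off a stretch of the boundary around the place where
   the previous edges end: keeping the vertices in a deque whose two ends meet
   at that place, clipping only pops vertices at both ends and pushes two new
   ones, which amortizes to O(n).  Remembering for each vertex of Pi which edges
   of Q it lies on, one knows for each vertex of Q the point of Pi nearest to
   it, so that the last step is a single comparison for each vertex. *)

(** The obstacle is that Pi may be empty, a point or a segment, and that clipping may leave sides of
    length zero, so the direction of a side cannot be recovered from its end points. Hence every
    vertex carries the index of an edge of Q, and all order arguments are about these indices.
    Within one turn starting at [dir i], the sign of [cross (dir i)] on the edge directions is first
    nonnegative and then negative, so a linear function along a chain with increasing indices rises
    and then falls. This one fact shows that the last vertex of the deque violates the next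
    half-plane most, that the kept vertices form a single stretch, and that the stored cycle bounds
    a convex set. Adding n to the index of a line already used keeps the indices increasing along
    the deque. For the last step, let x be a vertex of Pi on the lines j and k of two consecutive
    sides. For j <= c < k, the vector from x to [q c.+1] lies in the normal cone at x of the wedge
    cut out by these two lines, so x is the point of Pi nearest to [q c.+1]. *)

(** * Convex sets and disks *)

Section Convexity.
Variable R : realType.
Local Notation point := (R * R)%type.

Definition cross (x y : point) : R := x.1 * y.2 - x.2 * y.1.
Definition dot (x y : point) : R := x.1 * y.1 + x.2 * y.2.
Definition lerp (x y : point) (t : R) : point :=
  (x.1 + t * (y.1 - x.1), x.2 + t * (y.2 - x.2)).

Lemma point_eq (x y : point) : x.1 = y.1 -> x.2 = y.2 -> x = y.
Proof. by case: x => ? ?; case: y => ? ? /= -> ->. Qed.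

Lemma orientE (a b c : point) : orient a b c = cross (b - a) (c - a).
Proof. by []. Qed.

Lemma enorm_ge0 (x : point) : 0 <= enorm x.
Proof. exact: sqrtr_ge0. Qed.

Lemma sqr_enorm (x : point) : enorm x ^+ 2 = dot x x.
Proof. by rewrite sqr_sqrtr ?addr_ge0 ?sqr_ge0 // /dot !expr2. Qed.

Lemma enorm_le (x : point) (s : R) : 0 <= s -> (enorm x <= s) = (dot x x <= s ^+ 2).
Proof. by move=> s0; rewrite -sqr_enorm ler_pXn2r // nnegrE ?enorm_ge0. Qed.

Lemma enorm_lt (x : point) (s : R) : 0 <= s -> (enorm x < s) = (dot x x < s ^+ 2).
Proof. by move=> s0; rewrite -sqr_enorm ltr_pXn2r // nnegrE ?enorm_ge0. Qed.

Lemma enormN (x : point) : enorm (- x) = enorm x.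
Proof. by rewrite /enorm /= !sqrrN. Qed.

Lemma enorm_scale (t : R) (x : point) : enorm (t * x.1, t * x.2) = `|t| * enorm x.
Proof. by rewrite /enorm /= !exprMn -mulrDr sqrtrM ?sqr_ge0 // sqrtr_sqr. Qed.

Lemma dot_le_enorm (x y : point) : dot x y <= enorm x * enorm y.
Proof.
have nn := mulr_ge0 (enorm_ge0 x) (enorm_ge0 y).
have [d0|d0] := leP (dot x y) 0; first exact: le_trans d0 nn.
rewrite -(ler_pXn2r (ltn0Sn 1)) ?nnegrE ?(ltW d0) // exprMn !sqr_enorm.
(* Lagrange's identity: the squares of [dot] and [cross] add up to the product of the squared
   norms. *)
have := sqr_ge0 (cross x y); rewrite /dot /cross; nra.
Qed.

Lemma dot_self_ge0 (x : point) : 0 <= dot x x.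
Proof. by rewrite -sqr_enorm sqr_ge0. Qed.

Definition is_convex (T : set point) : Prop :=
  forall x y t, 0 <= t <= 1 -> T x -> T y -> T (lerp x y t).

Lemma polygon_convex n (q : 'I_n -> point) : is_convex (polygon q).
Proof.
move=> x y t /andP[t0 t1] [u [u0 u1 ->]] [w [w0 w1 ->]].
exists (fun i => (1 - t) * u i + t * w i); split.
- by move=> i; rewrite addr_ge0 ?mulr_ge0 ?subr_ge0.
- by rewrite big_split /= -!mulr_sumr u1 w1; lra.
- have E (g : 'I_n -> R) : \sum_i ((1 - t) * u i + t * w i) * g i =
      \sum_i u i * g i + t * (\sum_i w i * g i - \sum_i u i * g i).
    rewrite -sumrB mulr_sumr -big_split /=.
    by apply: eq_bigr => i _; ring.
  by rewrite /lerp /= !E.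
Qed.

Lemma polygon_vertex n (q : 'I_n -> point) i : polygon q (q i).
Proof.
exists (fun j => (j == i)%:R); split.
- by move=> j; rewrite ler0n.
- by rewrite (bigD1 i) //= eqxx big1 ?addr0 // => j /negPf ->.
- have E (g : 'I_n -> R) : \sum_j (j == i)%:R * g j = g i.
    rewrite (bigD1 i) //= eqxx mul1r big1 ?addr0 // => j /negPf ->.
    by rewrite mul0r.
  by rewrite !E -surjective_pairing.
Qed.

Lemma polygon_min n (q : 'I_n -> point) (T : set point) :
  is_convex T -> (forall i, T (q i)) -> polygon q `<=` T.
Proof.
move=> cT; elim: n q => [|n IH] q Tq x [w [w0 w1 ->]].
  by move: w1; rewrite big_ord0 => /eqP; rewrite eq_sym oner_eq0.
rewrite !big_ord_recr /=; move: w1; rewrite big_ord_recr /=.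
set wl := w ord_max; set W := \sum_(i < n) _ => w1.
have W0 : 0 <= W by apply: sumr_ge0.
(* If the other weights vanish, the point is the last vertex. Otherwise they are rescaled to sum 1,
   and the point lies between the resulting [y] and the last vertex. *)
have [W00|Wn0] := eqVneq W 0.
  have wz i : w (widen_ord (leqnSn n) i) = 0.
    by apply/eqP; move/eqP: W00; rewrite psumr_eq0 // => /allP/(_ i (mem_index_enum i)).
  have E (g : 'I_n -> R) : \sum_i w (widen_ord (leqnSn n) i) * g i = 0.
    by apply: big1 => i _; rewrite wz mul0r.
  rewrite !E !add0r; have -> : wl = 1 by lra.
  by rewrite !mul1r -surjective_pairing.
pose y : point := (\sum_i w (widen_ord (leqnSn n) i) / W * (q (widen_ord (leqnSn n) i)).1,
   \sum_i w (widen_ord (leqnSn n) i) / W * (q (widen_ord (leqnSn n) i)).2).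
have Ty : T y.
  apply: (IH (fun i => q (widen_ord (leqnSn n) i))) => //.
  exists (fun i => w (widen_ord (leqnSn n) i) / W); split=> //.
  - by move=> i; rewrite divr_ge0.
  - by rewrite -mulr_suml divff.
have wl0 : 0 <= wl := w0 ord_max.
have tl : 0 <= wl <= 1 by lra.
have := cT _ _ _ tl Ty (Tq ord_max).
have E (g : 'I_n -> R) : \sum_i w (widen_ord (leqnSn n) i) / W * g i =
    (\sum_i w (widen_ord (leqnSn n) i) * g i) / W.
  by rewrite mulr_suml; apply: eq_bigr => i _; rewrite mulrAC.
have Wl : 1 - wl = W by lra.
rewrite /lerp /y /= !E; congr (T (_, _)); rewrite -/wl mulrBr addrCA -{1}(mul1r (_ / W)) -mulrBl Wl;
  by field.
Qed.

Lemma offsetP (X : set point) s x :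
  offset X s x <-> exists2 y, X y & enorm (x - y) <= s.
Proof.
split=> [[y Xy [d ds <-]]|[y Xy ys]].
  by exists y => //; move: ds; rewrite /disk /= subr0 addrC addKr.
by exists y => //; exists (x - y); rewrite /disk /= ?subr0 // addrC subrK.
Qed.

Lemma insetP (X : set point) s x :
  inset X s x <-> forall y, enorm (x - y) <= s -> X y.
Proof.
rewrite /inset /setC /= offsetP; split=> [H y ys|H [y nXy ys]]; last exact/nXy/H.
by apply: contrapT => nXy; apply: H; exists y.
Qed.

Lemma lerpB (a b c e : point) t : lerp a b t - lerp c e t = lerp (a - c) (b - e) t.
Proof. by apply: point_eq => /=; ring. Qed.

Lemma enorm_lerp (a b : point) t s : 0 <= t <= 1 ->
  enorm a <= s -> enorm b <= s -> enorm (lerp a b t) <= s.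
Proof.
move=> /andP[t0 t1] ha hb; have s0 := le_trans (enorm_ge0 a) ha.
move: ha hb; rewrite !enorm_le // /lerp /dot /= => ha hb.
have u0 : 0 <= 1 - t by lra.
have h1 := ler_wpM2l u0 ha; have h2 := ler_wpM2l t0 hb.
have h3 := mulr_ge0 (mulr_ge0 t0 u0) (addr_ge0 (sqr_ge0 (a.1 - b.1)) (sqr_ge0 (a.2 - b.2))).
nra.
Qed.

Lemma offset_convex (X : set point) s : is_convex X -> is_convex (offset X s).
Proof.
move=> cX x y t t01 /offsetP[x' Xx' hx] /offsetP[y' Xy' hy].
apply/offsetP; exists (lerp x' y' t); first exact: cX.
by rewrite lerpB; apply: enorm_lerp.
Qed.

Lemma inset_convex (X : set point) s : is_convex X -> is_convex (inset X s).
Proof.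
move=> cX x y t t01 /insetP hx /insetP hy; apply/insetP => z hz.
(* The same displacement is applied to [x] and to [y], which puts [z] between two points of their
   disks. *)
pose u : point := lerp x y t - z.
have -> : z = lerp (x - u) (y - u) t by apply: point_eq => /=; ring.
by apply: cX => //; [apply: hx|apply: hy]; rewrite opprB addrC subrK.
Qed.

Lemma ConvexDecideE n (q : 'I_n -> point) (r eps : R) :
  ConvexDecide q r eps = Decide (polygon q) r eps.
Proof.
apply: asbool_equiv_eq; split=> [H|H i].
  apply: polygon_min.
    by apply/offset_convex/inset_convex/offset_convex/polygon_convex.
  move=> i; have [y [hy Piy]] := H i; apply/offsetP; exists y => //.
  by rewrite -opprB enormN.
have /offsetP[y Piy hy] := H _ (polygon_vertex q i).
by exists y; split=> //; rewrite /disk /= -opprB enormN.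
Qed.

End Convexity.

(** * Executions on the real RAM *)

(** An upper bound, read off the syntax, for the arrays that a command modifies. Through
    [ends_frame] it spares the specifications from listing what stays unchanged. *)
Fixpoint wwrites (c : cmd) : seq nat :=
  match c with
  | CSetW a _ _ => [:: a]
  | CSeq c1 c2 | CIf _ c1 c2 => wwrites c1 ++ wwrites c2
  | CWhile _ c1 => wwrites c1
  | _ => [::]
  end.

Fixpoint rwrites (c : cmd) : seq nat :=
  match c with
  | CSetR a _ _ => [:: a]
  | CSeq c1 c2 | CIf _ c1 c2 => rwrites c1 ++ rwrites c2
  | CWhile _ c1 => rwrites c1
  | _ => [::]
  end.

Section Execution.
Variable R : realType.
Implicit Types (s : state R) (c : cmd) (Q : nat -> state R -> Prop).

(** Total correctness in weakest-precondition form: the rules below chain by [apply], and the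
    running time accumulates inside the postcondition. *)
Definition ends c s Q : Prop := exists t s', exec c s t s' /\ Q t s'.

Lemma ends_weak c s Q Q' : ends c s Q -> (forall t s', Q t s' -> Q' t s') -> ends c s Q'.
Proof. by move=> [t [s' [e q]]] QQ'; exists t, s'; split=> //; apply: QQ'. Qed.

Lemma ends_seq c1 c2 s Q :
  ends c1 s (fun t1 s1 => ends c2 s1 (fun t2 s2 => Q (t1 + t2)%N s2)) ->
  ends (CSeq c1 c2) s Q.
Proof.
move=> [t1 [s1 [e1 [t2 [s2 [e2 q]]]]]]; exists (t1 + t2)%N, s2; split=> //.
exact: exec_seq e1 e2.
Qed.

Lemma ends_if b c1 c2 s Q :
  ends (if beval s b then c1 else c2) s (fun t s' => Q (bcost b + t).+1 s') ->
  ends (CIf b c1 c2) s Q.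
Proof.
by move=> [t [s' [e q]]]; exists (bcost b + t).+1, s'; split=> //; exact: exec_if.
Qed.

Lemma ends_skip s Q : Q 1%N s -> ends CSkip s Q.
Proof. by move=> q; exists 1%N, s; split=> //; exact: exec_skip. Qed.

(** The cell and the value written come back as variables with equations, which keeps the symbolic
    state small through long straight-line code. *)
Lemma ends_setw a i e c s Q :
  (forall k v, k = weval s i -> v = weval s e ->
     ends c (State (upd (wmem s) a k v) (rmem s))
       (fun t s' => Q ((wcost i + wcost e).+1 + t)%N s')) ->
  ends (CSeq (CSetW a i e) c) s Q.
Proof.
move=> H; apply: ends_seq; have h := H _ _ erefl erefl.
by eexists _, _; split; first exact: exec_setw.
Qed.

Lemma ends_setr a i e c s Q :
  (forall k v, k = weval s i -> v = reval s e ->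
     ends c (State (wmem s) (upd (rmem s) a k v))
       (fun t s' => Q ((wcost i + rcost e).+1 + t)%N s')) ->
  ends (CSeq (CSetR a i e) c) s Q.
Proof.
move=> H; apply: ends_seq; have h := H _ _ erefl erefl.
by eexists _, _; split; first exact: exec_setr.
Qed.

(* [pot] is a potential: it pays for the iterations still to come. *)
Lemma ends_while b c (I : state R -> Prop) (pot : state R -> nat) s Q :
  I s ->
  (forall s1, I s1 -> beval s1 b ->
     ends c s1 (fun t s2 => I s2 /\ (bcost b + t + pot s2 < pot s1)%N)) ->
  (forall t s', I s' -> beval s' b = false -> (t + pot s' <= pot s + (bcost b).+1)%N -> Q t s') ->
  ends (CWhile b c) s Q.
Proof.
move=> Is step HQ; suff [t [s' [e [Is' bs' ts']]]] :
    exists t s', exec (CWhile b c) s t s' /\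
      [/\ I s', beval s' b = false & (t + pot s' <= pot s + (bcost b).+1)%N].
  by exists t, s'; split=> //; apply: HQ.
move: {HQ Q} Is; have [m] := ubnP (pot s); elim: m s => // m IH s pm Is.
case E : (beval s b); last first.
  by exists (bcost b).+1, s; split; [exact: exec_while_false|split=> //; rewrite addnC].
have [t1 [s1 [e1 [I1 p1]]]] := step s Is E.
have [|t2 [s2 [e2 [I2 b2 p2]]]] := IH s1 _ I1; first by lia.
exists (bcost b + t1 + t2).+1, s2; split; first exact: exec_while_true e1 e2.
by split=> //; lia.
Qed.

Lemma exec_frame c s t s' : exec c s t s' ->
  (forall a, a \notin wwrites c -> wmem s' a = wmem s a) /\
  (forall a, a \notin rwrites c -> rmem s' a = rmem s a).
Proof.
elim=> {c s t s'} //=.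
- move=> s a i e; split=> // b; rewrite inE /upd => /negPf ba.
  by apply/funext => j; rewrite ba.
- move=> s a i e; split=> // b; rewrite inE /upd => /negPf ba.
  by apply/funext => j; rewrite ba.
- move=> c1 c2 s s1 s2 t1 t2 _ [w1 r1] _ [w2 r2].
  by split=> a; rewrite mem_cat negb_or => /andP[a1 a2]; rewrite ?w2 ?r2 ?w1 ?r1.
- move=> b c1 c2 s s1 t _ [w1 r1].
  by split=> a; rewrite mem_cat negb_or => /andP[a1 a2]; move: w1 r1; case: beval => w1 r1;
    rewrite ?w1 ?r1.
- move=> b c s s1 s2 t1 t2 _ _ [w1 r1] _ [w2 r2].
  by split=> a h; rewrite ?w2 ?r2 ?w1 ?r1.
Qed.

Lemma ends_frame c s Q : ends c s Q ->
  ends c s (fun t s' => [/\ Q t s',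
    (forall a, a \notin wwrites c -> wmem s' a = wmem s a) &
    (forall a, a \notin rwrites c -> rmem s' a = rmem s a)]).
Proof.
by move=> [t [s' [e q]]]; have [w r] := exec_frame e; exists t, s'.
Qed.

End Execution.

(** * Loops over the edges *)

Section ForLoop.
Variable R : realType.
Implicit Types (s : state R).

Definition wvar (a : nat) : wexp := WGet a (WConst 0).
Definition rvar (a : nat) : rexp := RGet a (WConst 0).
Definition incr (a : nat) : cmd := CSetW a (WConst 0) (WAdd (wvar a) (WConst 1)).
Definition input_size : wexp := WGet 0 (WConst 0).
Definition block (l : seq cmd) : cmd := foldr CSeq CSkip l.
Definition for_each_edge (body : cmd) : cmd :=
  CSeq (CSetW 1 (WConst 0) (WConst 0)) (CWhile (BLtW (wvar 1) input_size) body).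

(** Each iteration pays 6 for the loop test besides [K]; the 9 is the initialization (3) and the
    final failing test (6). The potential [pot] lets an iteration exceed [K] at the expense of
    earlier ones. *)
Lemma ends_for body s n K (I : nat -> state R -> Prop) (pot : state R -> nat) Q :
  wmem s 0 0 = n ->
  (forall s1, (forall a, a != 1%N -> wmem s1 a = wmem s a) -> rmem s1 = rmem s ->
     I 0%N s1 /\ pot s1 = pot s) ->
  (forall i s1, (i < n)%N -> I i s1 -> wmem s1 1 0 = i -> wmem s1 0 0 = n ->
     ends body s1 (fun t s2 => [/\ I i.+1 s2, wmem s2 1 0 = i.+1, wmem s2 0 0 = n &
       (t + pot s2 <= K + pot s1)%N])) ->
  (forall t s', I n s' -> wmem s' 0 0 = n ->
     (t + pot s' <= (K + 6) * n + 9 + pot s)%N -> Q t s') ->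
  ends (for_each_edge body) s Q.
Proof.
move=> sn I0 step HQ; apply: ends_setw => k v /= -> ->.
set s0 := State _ _.
have fr0 a : a != 1%N -> wmem s0 a = wmem s a.
  by move=> a1; apply/funext => j; rewrite /= /upd (negPf a1).
have [I0s pot0] := I0 s0 fr0 erefl.
pose J s1 := exists i, [/\ (i <= n)%N, I i s1, wmem s1 1 0 = i & wmem s1 0 0 = n].
apply: (@ends_while _ _ _ J (fun s1 => (K + 6) * (n - wmem s1 1 0) + pot s1)%N).
- by exists 0%N; split=> //; rewrite fr0.
- move=> s1 [i [_ Ii iE nE]] /=; rewrite iE nE => ltin.
  apply: ends_weak (step i s1 ltin Ii iE nE) _ => t s2 [Ii' iE' nE' tp].
  split; first by exists i.+1.
  rewrite iE'; have -> : (n - i = (n - i.+1).+1)%N by lia.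
  by rewrite mulnS; lia.
- move=> t s' [i [le Ii iE nE]] /=; rewrite iE nE => /negbT; rewrite -leqNgt => ge tp.
  have Ei : i = n by lia.
  apply: HQ => //; first by rewrite -Ei.
  by move: tp; rewrite Ei subnn muln0 pot0 /upd /= subn0; lia.
Qed.
End ForLoop.

(** * Convex polygons *)

Section Polygon.
Variable R : realType.
Local Notation point := (R * R)%type.
Implicit Types (x y : point) (T : set point).

(** The three orientations are the barycentric coordinates of [x], scaled by the area: [x] is
    reached by dividing the side [a b] in the right ratio and moving from there towards [c]. *)
Lemma triangle_sub T (a b c : point) x : is_convex T -> T a -> T b -> T c ->
  0 < orient a b c -> 0 <= orient a b x -> 0 <= orient b c x -> 0 <= orient c a x ->
  T x.
Proof.
move=> cT Ta Tb Tc A0 w0 u0 v0.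
have E : orient a b c = orient b c x + orient c a x + orient a b x.
  by rewrite /orient; ring.
have E1 : orient b c x * a.1 + orient c a x * b.1 + orient a b x * c.1 =
   orient a b c * x.1 by rewrite /orient; ring.
have E2 : orient b c x * a.2 + orient c a x * b.2 + orient a b x * c.2 =
   orient a b c * x.2 by rewrite /orient; ring.
move: E E1 E2 A0 w0 u0 v0.
set A := orient a b c; set u := orient b c x; set v := orient c a x.
set w := orient a b x => E E1 E2 A0 w0 u0 v0.
have [uv0|uv0] := eqVneq (u + v) 0.
  have -> : x = c; last by [].
  have u00 : u = 0 by lra.
  have v00 : v = 0 by lra.
  move: E E1 E2; rewrite u00 v00 !mul0r !add0r => <- /mulfI E1 /mulfI E2.
  by apply: point_eq; rewrite ?E1 ?E2 ?gt_eqF.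
have uvp : 0 < u + v by rewrite lt0r uv0 addr_ge0.
have -> : x = lerp (lerp a b (v / (u + v))) c (w / A).
  have An0 : A != 0 by rewrite gt_eqF.
  by apply: point_eq; apply: (mulfI An0); rewrite -?E1 -?E2 /= E;
     field; rewrite uv0 -E An0.
apply: (cT) => //.
  by rewrite divr_ge0 ?(ltW A0) //= ler_pdivrMr // mul1r E lerDr ltW.
by apply: cT => //; rewrite divr_ge0 ?(ltW uvp) //= ler_pdivrMr // mul1r lerDr.
Qed.

(** Cauchy-Schwarz for [a] turned by a quarter circle. *)
Lemma cross_ge (a b : point) : - (enorm a * enorm b) <= cross a b.
Proof.
have := dot_le_enorm (a.2, - a.1) b.
have -> : enorm (a.2, - a.1) = enorm a by rewrite /enorm /= sqrrN addrC.
rewrite /dot /cross /=; lra.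
Qed.

(** Vertices are indexed by all naturals with period [n]: one turn later is [i + n], and edges are
    ordered by direction without modular arithmetic. *)
Variables (n : nat) (q : nat -> point).
Hypothesis n_ge3 : (3 <= n)%N.
Hypothesis q_per : forall k, q (k + n) = q k.
Hypothesis q_conv : forall i k, (2 <= k)%N -> (k < n)%N ->
  0 < orient (q i) (q i.+1) (q (i + k)).

Definition dir i := q i.+1 - q i.
Definition side i x := cross (dir i) (x - q i).
Definition len i := enorm (dir i).

Lemma q_perM k m : q (k + m * n) = q k.
Proof. by elim: m => [|m IH]; rewrite ?addn0 // mulSn addnCA addnC q_per. Qed.

Lemma q_mod k : q (k %% n) = q k.
Proof. by rewrite {2}(divn_eq k n) addnC q_perM. Qed.

Lemma q_shift i k : exists2 m, (m < n)%N & q k = q (i + m).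
Proof.
have n0 : (0 < n)%N by lia.
exists ((k + (i * n - i)) %% n)%N; first by rewrite ltn_mod.
rewrite -[RHS]q_mod modnDmr addnCA subnKC ?leq_pmulr // addnC.
by rewrite modnMDl q_mod.
Qed.

Lemma dir_per i : dir (i + n) = dir i.
Proof. by rewrite /dir -addSn !q_per. Qed.

Lemma side_per i : side (i + n) = side i.
Proof. by rewrite /side dir_per q_per. Qed.

Lemma len_per i : len (i + n) = len i.
Proof. by rewrite /len dir_per. Qed.

Lemma side_q i k : 0 <= side i (q k).
Proof.
have [[|[|m]] mn ->] := q_shift i k.
- by rewrite addn0 /side subrr /cross !mulr0 subrr.
- by rewrite addn1 /side /cross mulrC subrr.
- by rewrite ltW //; apply: q_conv.
Qed.

Lemma cross_dirS i : 0 < cross (dir i) (dir i.+1).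
Proof.
have := @q_conv i 2 isT n_ge3; rewrite addn2 orientE -/(dir i) /dir /cross /=; lra.
Qed.

Lemma len_gt0 i : 0 < len i.
Proof.
rewrite lt0r enorm_ge0 andbT; apply/eqP => l0.
have := cross_dirS i; have := cross_ge (dir i.+1) (dir i).
rewrite -/(len i) l0 mulr0 oppr0 /cross; lra.
Qed.

(** In the identity [E] the left side is positive. If [dir (i + k)] is at least a half circle past
    [dir i], the first term on the right is at most 0, so the second one forces the next direction
    strictly beyond the half circle. *)
Lemma cross_dir_stepN i k : (0 < k)%N -> (k.+1 < n)%N ->
  cross (dir i) (dir (i + k)) <= 0 -> cross (dir i) (dir (i + k).+1) < 0.
Proof.
move=> k0 kn s0; rewrite ltNge; apply/negP => s1.
have gp : 0 < side i (q (i + k).+1) by rewrite -addnS; apply: q_conv.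
have aw : 0 < side (i + k) (q i).
  have := @q_conv (i + k) (n - k) ltac:(lia) ltac:(lia).
  by rewrite -addnA subnKC ?q_per //; lia.
have bw := side_q (i + k).+1 i.
have cc := cross_dirS (i + k).
have E : cross (dir (i + k)) (dir (i + k).+1) * side i (q (i + k).+1) =
  side (i + k).+1 (q i) * cross (dir i) (dir (i + k)) -
  side (i + k) (q i) * cross (dir i) (dir (i + k).+1).
  by rewrite /side /dir /cross /=; ring.
have h1 := mulr_gt0 cc gp; have h2 := mulr_ge0 (ltW aw) s1.
by have h3 := mulr_ge0_le0 bw s0; lra.
Qed.

(** The directions make just one full turn: once past the half circle from [dir i], they stay there
    until index [i + n]. *)
Lemma cross_dir_sign i j k : (i < j)%N -> (j < k)%N -> (k < i + n)%N ->
  cross (dir i) (dir j) <= 0 -> cross (dir i) (dir k) < 0.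
Proof.
move=> ij; elim: k => // k IH; rewrite ltnS leq_eqVlt => /predU1P[<-|jk] kn s0.
  have h := @cross_dir_stepN i (j - i); rewrite subnKC ?(ltnW ij) // in h.
  by apply: h => //; lia.
have h := @cross_dir_stepN i (k - i); rewrite subnKC in h; last lia.
by apply: h; [lia|lia|apply/ltW/IH => //; lia].
Qed.

Definition region : set point := polygon (fun i : 'I_n => q i).

Lemma region_vertex k : region (q k).
Proof.
have n0 : (0 < n)%N by lia.
rewrite -q_mod; exact: (polygon_vertex (fun i : 'I_n => q i) (Ordinal (ltn_pmod k n0))).
Qed.

Lemma side_convex i (s : R) : is_convex [set x | s <= side i x].
Proof.
move=> x y t /andP[t0 t1] /= hx hy; rewrite /side.
have -> : cross (dir i) (lerp x y t - q i) = (1 - t) * side i x + t * side i y.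
  by rewrite /side /cross /=; ring.
have u0 : 0 <= 1 - t by lra.
have := ler_wpM2l u0 hx; have := ler_wpM2l t0 hy; lra.
Qed.

(** Fan triangulation from [q 0]: the first [k] such that [x] is not strictly left of the line from
    [q 0] to [q k.+1] puts [x] into the triangle [q 0], [q k], [q k.+1]. The edge from [q n.-1] back
    to [q 0] guarantees such a [k]. *)
Lemma regionP x : region x <-> forall i, 0 <= side i x.
Proof.
split=> [Qx i|H].
  by apply: (polygon_min (@side_convex i 0)) Qx => k; apply: side_q.
pose P k := (0 < k)%N && (orient (q 0) (q k.+1) x <= 0).
have exP : exists k, P k.
  exists n.-2; rewrite /P; apply/andP; split; first by lia.
  have := H n.-1; rewrite /side -orientE prednK ?(ltn_trans _ n_ge3) //.
  have -> : q n = q 0%N by rewrite -[n in q n]add0n q_per.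
  have -> : n.-2.+1 = n.-1 by lia.
  by rewrite /orient; lra.
case: (ex_minnP exP) => k /andP[k0 ok] kmin.
have kn : (k <= n.-2)%N.
  apply: kmin; rewrite /P; apply/andP; split; first by lia.
  have := H n.-1; rewrite /side -orientE prednK ?(ltn_trans _ n_ge3) //.
  have -> : q n = q 0%N by rewrite -[n in q n]add0n q_per.
  have -> : n.-2.+1 = n.-1 by lia.
  by rewrite /orient; lra.
have ok' : 0 <= orient (q 0) (q k) x.
  case: k k0 ok kmin kn => [//|[|k]] _ ok kmin kn; first exact: (H 0%N).
  rewrite leNgt; apply/negP => neg.
  by have := kmin k.+1; rewrite /P (ltW neg) /= ltnn => /(_ isT).
apply: (@triangle_sub _ (q 0) (q k) (q k.+1)) => //; try exact: region_vertex.
- exact: polygon_convex.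
- have := @q_conv k (n - k) ltac:(lia) ltac:(lia).
  rewrite subnKC; last lia.
  have -> : q n = q 0%N by rewrite -[n in q n]add0n q_per.
  by rewrite /orient; lra.
- exact: (H k).
- by move: ok; rewrite /orient; lra.
Qed.

(** Outward, since the polygon lies to the left of its edges. *)
Definition normal i : point := ((dir i).2 / len i, - (dir i).1 / len i).

Lemma len_sqr i : len i * len i = (dir i).1 * (dir i).1 + (dir i).2 * (dir i).2.
Proof. by rewrite -expr2 sqr_enorm. Qed.

Lemma enorm_normal i : enorm (normal i) = 1.
Proof.
have l0 := len_gt0 i.
have -> : normal i = ((len i)^-1 * ((dir i).2, - (dir i).1).1,
   (len i)^-1 * ((dir i).2, - (dir i).1).2) by rewrite /normal mulrC [- _ / _]mulrC.
rewrite enorm_scale normfV gtr0_norm // {1}/enorm /= sqrrN addrC -/(enorm (dir i)) -/(len i).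
by rewrite mulVf ?gt_eqF.
Qed.

Lemma side_normal i x s :
  side i (x.1 + s * (normal i).1, x.2 + s * (normal i).2) = side i x - s * len i.
Proof.
have l0 : len i != 0 by rewrite gt_eqF ?len_gt0.
have E : len i = ((dir i).1 * (dir i).1 + (dir i).2 * (dir i).2) / len i.
  by rewrite -len_sqr mulfK.
by rewrite [X in _ - s * X]E /side /normal /cross /=; field.
Qed.

Lemma side_lip i x y s : enorm (x - y) <= s -> side i y - s * len i <= side i x.
Proof.
move=> hs; have := cross_ge (dir i) (x - y); rewrite -/(len i) => h.
have l0 := ltW (len_gt0 i).
have := ler_wpM2r l0 hs.
have -> : side i x = side i y + cross (dir i) (x - y).
  by rewrite /side /cross /=; ring.
by lra.
Qed.

(** Pi is Q eroded by [r - eps]. Necessity: [x] pushed by [r] along [normal i] must still be within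
    [eps] of Q. Sufficiency: for [y] within [r] of [x], the point [z] at the fraction
    [(r - eps) / r] of the way to [y] is in Q and within [eps] of [y]. *)
Lemma inset_offsetP r eps x : 0 < eps -> eps < r ->
  inset (offset region eps) r x <-> forall i, (r - eps) * len i <= side i x.
Proof.
move=> e0 er; split=> [/insetP H i|H].
  pose y : point := (x.1 + r * (normal i).1, x.2 + r * (normal i).2).
  have /H /offsetP[z Qz hz] : enorm (x - y) <= r.
    have -> : x - y = ((- r) * (normal i).1, (- r) * (normal i).2).
      by apply: point_eq => /=; ring.
    by rewrite enorm_scale enorm_normal normrN mulr1 gtr0_norm //; lra.
  have := side_lip i hz; have /regionP/(_ i) := Qz; rewrite side_normal.
  lra.
apply/insetP => y hy; apply/offsetP.
have r0 : 0 < r by lra.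
pose z : point := (x.1 + (r - eps) / r * (y.1 - x.1), x.2 + (r - eps) / r * (y.2 - x.2)).
have hy' : enorm (y - x) <= r by rewrite -enormN opprB.
exists z.
  apply/regionP => i.
  have /(side_lip i) : enorm (z - x) <= r - eps.
    have -> : z - x = ((r - eps) / r * (y - x).1, (r - eps) / r * (y - x).2).
      by apply: point_eq => /=; ring.
    have t0 : 0 <= (r - eps) / r by rewrite divr_ge0; lra.
    rewrite enorm_scale ger0_norm // -[leRHS](@divfK _ r) ?gt_eqF //.
    exact: ler_wpM2l.
  by have := H i; lra.
have -> : y - z = (eps / r * (y - x).1, eps / r * (y - x).2).
  have rn0 : r != 0 by rewrite gt_eqF.
  by apply: point_eq => /=; field.
have t0 : 0 <= eps / r by rewrite divr_ge0; lra.
rewrite enorm_scale ger0_norm // -[leRHS](@divfK _ r) ?gt_eqF //.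
exact: ler_wpM2l.
Qed.

(** * Clipping *)

Variable delta : R.
Hypothesis delta_gt0 : 0 < delta.

(** The signed distance to the clipping line times [len i]: the factor avoids a division and does
    not affect the sign. *)
Definition depth i x := side i x - delta * len i.

Lemma depth_per i : depth (i + n) = depth i.
Proof. by rewrite /depth side_per len_per. Qed.

Lemma depthD i x y : depth i y = depth i x + cross (dir i) (y - x).
Proof. by rewrite /depth /side /cross /=; ring. Qed.

Lemma depth_lerp i x y t : depth i (lerp x y t) = (1 - t) * depth i x + t * depth i y.
Proof. by rewrite /depth /side /cross /=; ring. Qed.

Definition scale (t : R) (x : point) : point := (t * x.1, t * x.2).

Definition item := (nat * point)%type.

(* A vertex carries the index of the edge of [q] to which the side ending in
   it is parallel; this index still makes sense when that side has length 0. *)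
Definition joined (u v : item) : bool :=
  `[< (exists2 t, 0 <= t & v.2 - u.2 = scale t (dir v.1)) /\
      0 < cross (dir u.1) (dir v.1) >].

Definition shift (u : item) : item := ((u.1 + n)%N, u.2).

Lemma joined_shiftr u v : joined u (shift v) = joined u v.
Proof. by rewrite /joined /shift /= dir_per. Qed.

Lemma joined_shiftl u v : joined (shift u) v = joined u v.
Proof. by rewrite /joined /shift /= dir_per. Qed.

Lemma path_shift u s : path joined u (map shift s) = path joined u s.
Proof.
elim: s u => //= v s IH u; rewrite joined_shiftr IH; congr (_ && _).
by case: s {IH} => //= w s; rewrite joined_shiftl.
Qed.

Lemma joinedP i u v : joined u v -> exists2 t, 0 <= t &
  cross (dir i) v.2 = cross (dir i) u.2 + t * cross (dir i) (dir v.1).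
Proof.
case/asboolP=> -[t t0 E] _; exists t => //.
have -> : v.2 = u.2 + (v.2 - u.2) by rewrite addrC subrK.
by rewrite E /cross /scale /=; ring.
Qed.

Definition tags (s : seq item) := [seq u.1 | u <- s].

(** Past the half circle every further side goes down, by [cross_dir_sign]. *)
Lemma path_desc i u s : (i < u.1)%N -> cross (dir i) (dir u.1) <= 0 ->
  path ltn u.1 (tags s) -> all (fun k => k < i + n)%N (tags s) -> path joined u s ->
  forall v, v \in u :: s -> cross (dir i) (last u s).2 <= cross (dir i) v.2.
Proof.
elim: s u => [|w s IH] u iu cu /=; first by move=> _ _ _ v; rewrite inE => /eqP ->.
move=> /andP[uw ws] /andP[wn sn] /andP[juw js] v.
have cw := cross_dir_sign iu uw wn cu.
have H := IH w (ltn_trans iu uw) (ltW cw) ws sn js.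
rewrite inE => /predU1P[->|]; last exact: H.
apply: (le_trans (H w (mem_head _ _))).
have [t t0 ->] := joinedP i juw.
by have := mulr_ge0_le0 t0 (ltW cw); lra.
Qed.

(** The height over [dir i] rises while the tags are less than a half circle past [i] and falls
    afterwards, so its minimum over the chain is attained at an end. *)
Lemma path_unimodal i u s (m : R) :
  sorted ltn (tags s) -> all (fun k => i <= k < i + n)%N (tags s) -> path joined u s ->
  m <= cross (dir i) u.2 -> m <= cross (dir i) (last u s).2 ->
  forall v, v \in u :: s -> m <= cross (dir i) v.2.
Proof.
elim: s u => [|w s IH] u /=; first by move=> _ _ _ mu _ v; rewrite inE => /eqP ->.
move=> sw /andP[/andP[iw wn] sn] /andP[juw js] mu ml v.
rewrite inE => /predU1P[->//|vs].
have [t t0 E] := joinedP i juw.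
have [wu|uw] := leP (cross (dir i) u.2) (cross (dir i) w.2).
  by apply: (IH w) => //; [exact: path_sorted sw|exact: le_trans mu wu].
have cw : cross (dir i) (dir w.1) < 0.
  by rewrite ltNge; apply/negP => c0; have := mulr_ge0 t0 c0; lra.
have iw' : (i < w.1)%N.
  rewrite ltn_neqAle iw andbT; apply/eqP => iE; move: cw.
  by rewrite -iE /cross mulrC subrr ltxx.
apply: le_trans ml _; apply: (path_desc iw' (ltW cw)) => //.
by apply: sub_all sn => k /andP[].
Qed.

(** Start the cycle at [u] and move the vertices before it one turn ahead: the tags then increase
    within one turn from [u.1]. The predecessor [z] of [u] has the same height over [dir u.1] as
    [u], because the side from [z] to [u] is parallel to it. Both ends of the chain are thus level
    with [u], and [path_unimodal] applies. *)
Lemma left_of i s : sorted ltn (tags s) ->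
  all (fun k => i <= k < i + n)%N (tags s) -> cycle joined s ->
  forall u v, u \in s -> v \in s -> 0 <= cross (dir u.1) (v.2 - u.2).
Proof.
move=> st sn cs u v us vs.
suff : cross (dir u.1) u.2 <= cross (dir u.1) v.2 by rewrite /cross /=; lra.
case/splitPr: us st sn cs vs => A B.
rewrite /tags map_cat /= all_cat /= => st /and3P[An un Bn].
rewrite -(rot_cycle (size A)) rot_size_cat cat_cons /= rcons_path => /andP[].
set z := last u (B ++ A) => pBA jz vs.
have p2 : path joined u (B ++ map shift A).
  by move: pBA; rewrite !cat_path path_shift.
have tE : tags (map shift A) = map (addn^~ n) (tags A) by rewrite /tags -!map_comp.
have bA k : k \in tags (map shift A) -> (i + n <= k < u.1 + n)%N.
  rewrite tE => /mapP[a aA ->]; rewrite leq_add2r ltn_add2r.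
  have /andP[-> _] := allP An a aA; rewrite /=.
  move: st; rewrite (sorted_pairwise ltn_trans) pairwise_cat => /andP[/allrelP H _].
  exact: (H _ _ aA (mem_head _ _)).
have st2 : path ltn u.1 (tags (B ++ map shift A)).
  move: st; rewrite -[path _ _ _]/(sorted ltn (u.1 :: tags _)).
  have -> : u.1 :: tags (B ++ map shift A) = (u.1 :: tags B) ++ tags (map shift A).
    by rewrite /tags map_cat.
  rewrite !(sorted_pairwise ltn_trans) !pairwise_cat => /and3P[_ pA pB].
  apply/and3P; split=> //.
    apply/allrelP => x y xB /bA/andP[y1 _]; apply: leq_trans y1.
    by move: xB; rewrite inE => /predU1P[->|/(allP Bn)/andP[]//]; case/andP: un.
  by rewrite tE pairwise_map; apply: sub_pairwise pA => x y /=; rewrite ltn_add2r.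
have zE : (last u (B ++ map shift A)).2 = z.2.
  rewrite /z !last_cat; case: (lastP A) => //= A' a.
  by rewrite map_rcons !last_rcons.
have gz : cross (dir u.1) z.2 = cross (dir u.1) u.2.
  have [t _ ->] := joinedP u.1 jz.
  by rewrite [cross (dir u.1) (dir u.1)]/cross [X in _ - X]mulrC subrr mulr0 addr0.
have [w wE ->] : exists2 w, w \in u :: B ++ map shift A & v.2 = w.2.
  move: vs; rewrite mem_cat inE => /or3P[vA|/eqP ->|vB].
  - by exists (shift v) => //; rewrite inE mem_cat map_f ?orbT.
  - by exists u => //; exact: mem_head.
  - by exists v => //; rewrite inE mem_cat vB ?orbT.
apply: (@path_unimodal u.1 u (B ++ map shift A)) => //.
- exact: path_sorted st2.
- have /andP[iu un'] := un.
  apply/allP => k; rewrite /tags map_cat mem_cat => /orP[kB|/bA/andP[k1 k2]].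
    2: by apply/andP; split; [exact: leq_trans (ltnW un') k1|exact: k2].
  have /andP[_ kn] := allP Bn k kB.
  move: st2 => /(order_path_min ltn_trans)/allP/(_ k).
  rewrite /tags map_cat mem_cat kB => /(_ isT) /ltnW -> /=.
  by apply: leq_trans kn _; rewrite leq_add2r.
- by rewrite zE gz.
Qed.

(** The convex hull as an intersection: inclusions are proved by choosing [T], with no weights to
    handle. *)
Definition hull (s : seq item) (y : point) : Prop :=
  forall T, is_convex T -> (forall u, u \in s -> T u.2) -> T y.

Lemma hull_sub s T : is_convex T -> (forall u, u \in s -> T u.2) -> hull s `<=` T.
Proof. by move=> cT sT y /(_ T cT sT). Qed.

Lemma hull_mem s u : u \in s -> hull s u.2.
Proof. by move=> us T _ sT; apply: sT. Qed.

Lemma hull_convex s : is_convex (hull s).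
Proof. by move=> x y t t01 hx hy T cT sT; apply: (cT) => //; [apply: hx|apply: hy]. Qed.

(* After [i] steps the indices range over [i, i + n): those of the lines that
   have been used for clipping are shifted by [n]. *)
Definition clip_inv i (s : seq item) : Prop :=
  [/\ sorted ltn (tags s), all (fun k => i <= k < i + n)%N (tags s), cycle joined s,
      (forall u, u \in s -> side u.1 u.2 = if (n <= u.1)%N then delta * len u.1 else 0) &
      forall y, hull s y <-> region y /\ forall j, (j < i)%N -> 0 <= depth j y].

Lemma depth_convex i (m : R) : is_convex [set x | m <= depth i x].
Proof.
move=> x y t /andP[t0 t1] /= hx hy; rewrite depth_lerp.
have u0 : 0 <= 1 - t by lra.
have := ler_wpM2l u0 hx; have := ler_wpM2l t0 hy; lra.
Qed.

Lemma depth_concave i (m : R) : is_convex [set x | depth i x < m].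
Proof.
move=> x y t /andP[t0 t1] /= hx hy; rewrite depth_lerp.
have [->|tn0] := eqVneq t 0; first by rewrite subr0 mul1r mul0r addr0.
have t0' : 0 < t by rewrite lt0r tn0.
have u0 : 0 <= 1 - t by lra.
have := ler_wpM2l u0 (ltW hx); have := hy; rewrite -(ltr_pM2l t0'); lra.
Qed.

(** The tag names the side that ends in the vertex, hence the shift by one. *)
Definition initial : seq item := [seq (k, q k.+1) | k <- iota 0 n].

Lemma joined_initial k : joined (k, q k.+1) (k.+1, q k.+2).
Proof.
apply/asboolP; split; last exact: cross_dirS.
by exists 1 => //; apply: point_eq; rewrite /scale /= mul1r.
Qed.

Lemma clip_inv_initial : clip_inv 0 initial.
Proof.
have tE : tags initial = iota 0 n by rewrite /tags -map_comp map_id.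
split; rewrite ?tE.
- exact: iota_ltn_sorted.
- by apply/allP => k; rewrite mem_iota.
- have pth k m : path joined (k, q k.+1) [seq (j, q j.+1) | j <- iota k.+1 m].
    by elim: m k => //= m IH k; rewrite joined_initial IH.
  rewrite /initial; case En : n => [|m]; first by move: n_ge3; rewrite En.
  rewrite /= rcons_path pth /=.
  have -> : last (0%N, q 1%N) [seq (j, q j.+1) | j <- iota 1 m] = (m, q m.+1).
    have lE k l : last (k, q k.+1) [seq (j, q j.+1) | j <- iota k.+1 l] =
        ((k + l)%N, q (k + l).+1).
      by elim: l k => [|l IH] k; rewrite ?addn0 //= IH addSnnS.
    exact: lE.
  (* The cycle closes because item 0, seen one turn later, is the successor of the last item. *)
  by rewrite -joined_shiftr /shift add0n /= -(q_per 1) add1n En joined_initial.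
- move=> u /mapP[k]; rewrite mem_iota add0n => /andP[_ kn] -> /=.
  by rewrite leqNgt kn /= /side /cross mulrC subrr.
- move=> y; split=> [hy|[Qy _] T cT sT].
    split=> //; apply: hy; first exact: polygon_convex.
    by move=> u /mapP[k _ ->]; apply: region_vertex.
  apply: (polygon_min cT) Qy => k.
  have [m mn ->] := q_shift 1 k.
  rewrite add1n; apply: (sT (m, q m.+1)).
  by apply: (map_f (fun k => (k, q k.+1))); rewrite mem_iota.
Qed.

Lemma clip_inv_empty i s : clip_inv i s -> (forall u, u \in s -> depth i u.2 < 0) ->
  clip_inv i.+1 [::].
Proof.
move=> [_ _ _ _ hs] neg; split=> //= y; split.
  by move=> hy; have : set0 y by apply: hy => [? ? ? _ []|].
move=> [Qy dy]; have /hs /(_ _ (@depth_concave i 0) neg) /= :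
    region y /\ forall j, (j < i)%N -> 0 <= depth j y.
  by split=> // j ji; apply/dy/ltnW.
by have := dy i (ltnSn i); rewrite leNgt => /negbTE ->.
Qed.

(** The tags lie in [[i, i + n)], so a walk around the cycle from the last vertex back to itself
    meets the directions in order from [dir i] on: the depth rises and then falls. *)
Lemma last_min i u s : clip_inv i (u :: s) ->
  forall v, v \in u :: s -> depth i (last u s).2 <= depth i v.2.
Proof.
move=> [st sn cs _ _] v vs.
have p : path joined (last u s) (u :: s) by move: cs; rewrite /= rcons_path andbC.
have := @path_unimodal i _ (u :: s) _ st sn p (lexx _) (lexx _).
move=> /(_ v); rewrite inE vs orbT => /(_ isT).
by rewrite /depth /side /cross /=; lra.
Qed.

Lemma clip_inv_skip i u s : (i < n)%N -> clip_inv i (u :: s) ->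
  0 <= depth i (last u s).2 -> clip_inv i.+1 (u :: s).
Proof.
move=> ln inv pos; have lm := last_min inv.
case: inv => st sn cs sd hs; split=> //.
- apply/allP => k /mapP[v vs kE]; rewrite addSn.
  have := allP sn k; rewrite kE map_f // => /(_ isT)/andP[iv vn].
  (* A vertex with tag [i] would lie on the edge line [i] itself, hence at negative depth. *)
  rewrite (leqW vn) andbT ltn_neqAle iv andbT; apply/eqP => iE.
  have := le_trans pos (lm v vs).
  rewrite /depth iE sd // leqNgt -iE ln /=.
  by have := mulr_gt0 delta_gt0 (len_gt0 i); lra.
- move=> y; rewrite hs; split=> [[Qy dy]|[Qy dy]]; split=> // j.
    rewrite ltnS leq_eqVlt => /predU1P[->|]; last exact: dy.
    have /hs hy : region y /\ forall j, (j < i)%N -> 0 <= depth j y by split.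
    by apply: (hy _ (@depth_convex i 0)) => v vs; apply: le_trans pos (lm v vs).
  by move=> ji; apply/dy/ltnW.
Qed.

Definition cut i (x y : point) : point :=
  lerp x y (depth i x / (depth i x - depth i y)).

Lemma parallel (D w : point) : 0 < dot D D -> cross D w = 0 ->
  w = scale (dot D w / dot D D) D.
Proof.
move=> D0 c0; have Dn0 : dot D D != 0 by rewrite gt_eqF.
have E1 : dot D w * D.1 = dot D D * w.1 + D.2 * cross D w by rewrite /dot /cross; ring.
have E2 : dot D w * D.2 = dot D D * w.2 - D.1 * cross D w by rewrite /dot /cross; ring.
apply: point_eq; rewrite /scale /= mulrAC ?E1 ?E2 c0 mulr0 ?subr0 ?addr0.
  by rewrite mulrAC divff // mul1r.
by rewrite mulrAC divff // mul1r.
Qed.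

Lemma depth_cut i x y : depth i x != depth i y -> depth i (cut i x y) = 0.
Proof.
move=> xy; rewrite /cut depth_lerp.
by field; rewrite subr_eq0.
Qed.

Lemma dot_dir_gt0 i : 0 < dot (dir i) (dir i).
Proof. by rewrite -sqr_enorm exprn_gt0 ?len_gt0. Qed.

Lemma joined_depth i u v : joined u v -> exists2 t, 0 <= t &
  depth i v.2 = depth i u.2 + t * cross (dir i) (dir v.1).
Proof.
move=> /(joinedP i)[t t0 E]; exists t => //.
by move: E; rewrite /depth /side /cross /=; lra.
Qed.

Lemma cross_scale (D : point) t : cross D (scale t D) = 0.
Proof. by rewrite /cross /scale /=; ring. Qed.

Lemma halfplane_convex (D c : point) : is_convex [set y | 0 <= cross D (y - c)].
Proof.
move=> x y t /andP[t0 t1] /= hx hy.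
have -> : cross D (lerp x y t - c) = (1 - t) * cross D (x - c) + t * cross D (y - c).
  by rewrite /cross /=; ring.
by apply: addr_ge0; apply: mulr_ge0 => //; rewrite subr_ge0.
Qed.

Lemma lerp_sym (x y : point) t : lerp x y t = lerp y x (1 - t).
Proof. by apply: point_eq => /=; ring. Qed.

(** The part of the segment at nonnegative depth ends in the cut point, which lies in [T] by the
    hypothesis about the clipping line. *)
Lemma cut_sub i (S T : set point) x y t : is_convex S -> is_convex T ->
  (forall z, S z -> depth i z = 0 -> T z) -> S x -> S y -> T x ->
  0 <= depth i x -> depth i y < 0 -> 0 <= t <= 1 ->
  0 <= depth i (lerp x y t) -> T (lerp x y t).
Proof.
move=> cS cT ST Sx Sy Tx x0 y0 t01; have /andP[t0 t1] := t01.
rewrite depth_lerp => z0.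
have d0 : 0 < depth i x - depth i y by lra.
pose tau := depth i x / (depth i x - depth i y).
have tau1 : 0 <= tau <= 1.
  by rewrite divr_ge0 ?(ltW d0) //= ler_pdivrMr // mul1r; lra.
have ttau : t <= tau by rewrite ler_pdivlMr //; lra.
have Tc : T (cut i x y).
  apply: ST; first exact: cS.
  by apply: depth_cut; rewrite gt_eqF //; lra.
have [tau0|taun0] := eqVneq tau 0.
  have -> : lerp x y t = x; last by [].
  have -> : t = 0 by lra.
  by apply: point_eq => /=; ring.
have taup : 0 < tau by rewrite lt0r taun0; lra.
have -> : lerp x y t = lerp x (cut i x y) (t / tau).
  by rewrite /cut -/tau; apply: point_eq => /=; field.
by apply: cT => //; rewrite divr_ge0 ?(ltW taup) //= ler_pdivrMr // mul1r.
Qed.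

Lemma between_sub (T : set point) (D p1 p2 z : point) s1 s2 : is_convex T -> T p1 -> T p2 ->
  0 <= s1 -> s2 <= 0 -> z - p1 = scale s1 D -> z - p2 = scale s2 D -> T z.
Proof.
move=> cT T1 T2 s1_ge0 s2_le0 e1 e2.
have [w0|wn0] := eqVneq (s1 - s2) 0.
  have -> : z = p1; last exact: T1.
  have s10 : s1 = 0 by lra.
  by apply/eqP; rewrite -subr_eq0 e1 s10; apply/eqP/point_eq; rewrite /scale /= mul0r.
have wp : 0 < s1 - s2 by rewrite lt0r wn0; lra.
have -> : z = lerp p1 p2 (s1 / (s1 - s2)).
  have p2E : p2 - p1 = scale (s1 - s2) D.
    have -> : p2 - p1 = (z - p1) - (z - p2) by apply: point_eq => /=; ring.
    by rewrite e1 e2; apply: point_eq; rewrite /scale /=; ring.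
  have -> : lerp p1 p2 (s1 / (s1 - s2)) = p1 + scale (s1 / (s1 - s2)) (p2 - p1) by [].
  rewrite p2E; have -> : z = p1 + scale s1 D by rewrite -e1 addrC subrK.
  by apply: point_eq; rewrite /scale /= mulrA divfK.
by apply: cT => //; rewrite divr_ge0 ?ler_pdivrMr ?mul1r //; lra.
Qed.

(** The set [T] of the points that satisfy the claim contains the vertices, so it suffices that it
    is convex: a segment that leaves the half-plane crosses the clipping line inside [hull N]. *)
Lemma hull_clip i (s N : seq item) :
  (forall u, u \in s -> 0 <= depth i u.2 -> hull N u.2) ->
  (forall z, hull s z -> depth i z = 0 -> hull N z) ->
  forall y, hull s y -> 0 <= depth i y -> hull N y.
Proof.
move=> sN segN y hy dy.
pose T := [set z | hull s z /\ (0 <= depth i z -> hull N z)].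
have cT : is_convex T.
  move=> x z t t01 [hx Nx] [hz Nz]; split; first exact: hull_convex.
  move=> d0; have [x0|x0] := leP 0 (depth i x); have [z0|z0] := leP 0 (depth i z).
  - by apply: hull_convex; [|apply: Nx|apply: Nz].
  - exact: (cut_sub (@hull_convex s) (@hull_convex N) segN hx hz (Nx x0)).
  - rewrite lerp_sym; apply: (cut_sub (@hull_convex s) (@hull_convex N) segN hz hx (Nz z0)) => //.
      by case/andP: t01 => ? ?; rewrite subr_ge0 lerBlDr lerDl; apply/andP.
    by rewrite -lerp_sym.
  - by have := depth_concave t01 x0 z0; rewrite /= ltNge d0.
have [_ ] : T y by apply: hy => // u us; split; [exact: hull_mem|exact: sN].
exact.
Qed.

Lemma cut_ratio (x y : R) : x < 0 -> 0 <= y -> 0 <= x / (x - y) <= 1.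
Proof.
move=> x0 y0; have d0 : 0 < y - x by lra.
have -> : x / (x - y) = - x / (y - x) by rewrite -(opprB y x) invrN mulrN mulNr.
by rewrite divr_ge0 ?(ltW d0) //= ?ler_pdivrMr ?mul1r //; lra.
Qed.

Lemma cut_ratio_pos (x y : R) : 0 <= x -> y < 0 -> 0 <= x / (x - y) <= 1.
Proof.
move=> x0 y0; have d0 : 0 < x - y by lra.
by rewrite divr_ge0 ?(ltW d0) //= ?ler_pdivrMr ?mul1r //; lra.
Qed.

(** [A] and [B] are the stretches popped at the two ends. After the last kept vertex [l] come [p1]
    on the side ending in [b], then [p2] on the clipping line, then [k] again. So [p1] inherits the
    tag of [b], [p2] gets the clipping index one turn ahead, and [k] keeps its tag because its side
    is only shortened. *)
Lemma clip_inv_cut i (A B : seq item) (k b : item) (K : seq item) :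
  let s := A ++ (k :: K) ++ b :: B in
  let a := last (last b B) A in
  (i < n)%N -> clip_inv i s -> (forall u, u \in A -> depth i u.2 < 0) ->
  (forall u, u \in b :: B -> depth i u.2 < 0) ->
  0 <= depth i k.2 -> 0 <= depth i (last k K).2 ->
  clip_inv i.+1 (k :: K ++ [:: (b.1, cut i (last k K).2 b.2); ((i + n)%N, cut i a.2 k.2)]).
Proof.
move=> s a ln inv A_lt0 B_lt0 k_ge0 l_ge0.
have [st sn cs sd hs] := inv.
have a_lt0 : depth i a.2 < 0.
  have := mem_last (last b B) A; rewrite -/a inE => /predU1P[->|/A_lt0 //].
  exact/B_lt0/mem_last.
have b_lt0 : depth i b.2 < 0 by apply: B_lt0; exact: mem_head.
set l := last k K in l_ge0 *; set p1 := cut i _ _; set p2 := cut i _ _.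
(* Rotating by [A] shows [a] as the predecessor of [k], also when [A] is empty and [a] ends [B]. *)
have : path joined a ((k :: K) ++ b :: B).
  have sE : rot (size A) s = k :: (K ++ b :: B) ++ A by rewrite rot_size_cat.
  move: cs; rewrite -(rot_cycle (size A)) sE /= rcons_path cat_path !last_cat.
  by rewrite /= -/a => /andP[/andP[-> _] ->].
rewrite cat_path /= -/l => /and3P[/andP[jak jK] jlb jB].
have [ta ta0 Ea] := joined_depth i jak.
have [tb tb0 Eb] := joined_depth i jlb.
have ck : 0 < cross (dir i) (dir k.1).
  by rewrite ltNge; apply/negP => c0; have := mulr_ge0_le0 ta0 c0; lra.
have cb : cross (dir i) (dir b.1) < 0.
  by rewrite ltNge; apply/negP => c0; have := mulr_ge0 tb0 c0; lra.
have KL u : u \in k :: K -> u \in s by move=> uK; rewrite !mem_cat uK orbT.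
(* The kept chain is unimodal and both its ends have nonnegative depth; the threshold is depth 0
   expressed through [cross (dir i)]. *)
have K_ge0 u : u \in k :: K -> 0 <= depth i u.2.
  move=> uK; have := @path_unimodal i k K (cross (dir i) (q i) + delta * len i).
  have stK : sorted ltn (tags K).
    move: st; rewrite /s /tags !map_cat => /cat_sorted2[_].
    by rewrite /= cat_path => /andP[/path_sorted].
  have snK : all (fun j => i <= j < i + n)%N (tags K).
    by move: sn; rewrite /s /tags !map_cat !all_cat /= => /and3P[_ /andP[_ ->]].
  move=> /(_ stK snK jK) H; have := H _ _ u uK.
  by move: k_ge0 l_ge0; rewrite /depth /side /cross /=; lra.
have p1_0 : depth i p1 = 0.
  by apply: depth_cut; rewrite gt_eqF //; apply: lt_le_trans l_ge0.
have p2_0 : depth i p2 = 0.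
  by apply: depth_cut; rewrite lt_eqF //; apply: lt_le_trans k_ge0.
have bs : b \in s by rewrite !mem_cat mem_head !orbT.
have as_ : a \in s.
  have := mem_last (last b B) A; rewrite -/a inE => /predU1P[->|aA].
    by rewrite !mem_cat mem_last !orbT.
  by rewrite !mem_cat aA.
have t1 : 0 <= depth i l.2 / (depth i l.2 - depth i b.2) <= 1 by exact: cut_ratio_pos.
have t2 : 0 <= depth i a.2 / (depth i a.2 - depth i k.2) <= 1 by exact: cut_ratio.
have h1 : hull s p1.
  apply: hull_convex => //; apply: hull_mem => //.
  by apply: KL; exact: mem_last.
have h2 : hull s p2.
  by apply: hull_convex => //; apply: hull_mem => //; apply: KL; exact: mem_head.
have [[sb sb0 Eb'] cbl] : (exists2 t, 0 <= t & b.2 - l.2 = scale t (dir b.1)) /\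
    0 < cross (dir l.1) (dir b.1) by exact/asboolP.
have [[sa sa0 Ea'] cka] : (exists2 t, 0 <= t & k.2 - a.2 = scale t (dir k.1)) /\
    0 < cross (dir a.1) (dir k.1) by exact/asboolP.
set t_1 := _ / _ in t1; set t_2 := _ / _ in t2.
(* Cutting moves a vertex only along its side, so half-planes based at the old vertices may be based
   at the new ones. *)
have X1 y : cross (dir b.1) (y - p1) = cross (dir b.1) (y - b.2).
  have -> : cross (dir b.1) (y - p1) = cross (dir b.1) (y - b.2) +
      (1 - t_1) * cross (dir b.1) (b.2 - l.2).
    by rewrite /p1 /cut -/t_1 /cross /=; ring.
  by rewrite Eb' cross_scale mulr0 addr0.
have X2 y : cross (dir k.1) (y - p2) = cross (dir k.1) (y - k.2).
  have -> : cross (dir k.1) (y - p2) = cross (dir k.1) (y - k.2) +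
      (1 - t_2) * cross (dir k.1) (k.2 - a.2).
    by rewrite /p2 /cut -/t_2 /cross /=; ring.
  by rewrite Ea' cross_scale mulr0 addr0.
(* On the clipping line, the half-planes of the sides ending in [b] and [k] leave only the chord
   from [p1] to [p2]. *)
have seg y : hull s y -> depth i y = 0 ->
    (exists2 t, 0 <= t & y - p1 = scale t (dir i)) /\
    (exists2 t, t <= 0 & y - p2 = scale t (dir i)).
  move=> hy y0.
  have c1 : cross (dir i) (y - p1) = 0 by have := depthD i p1 y; lra.
  have c2 : cross (dir i) (y - p2) = 0 by have := depthD i p2 y; lra.
  have := parallel (dot_dir_gt0 i) c1; set s1 := _ / _ => e1.
  have := parallel (dot_dir_gt0 i) c2; set s2 := _ / _ => e2.
  split; [exists s1|exists s2] => //.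
    have : 0 <= cross (dir b.1) (y - p1).
      rewrite X1; apply: (hy _ (@halfplane_convex (dir b.1) b.2)) => v vs.
      exact: (left_of st sn cs).
    rewrite e1; have -> : cross (dir b.1) (scale s1 (dir i)) = s1 * - cross (dir i) (dir b.1).
      by rewrite /cross /scale /=; ring.
    by rewrite pmulr_lge0 // oppr_gt0.
  have : 0 <= cross (dir k.1) (y - p2).
    rewrite X2; apply: (hy _ (@halfplane_convex (dir k.1) k.2)) => v vs.
    by apply: (left_of st sn cs) => //; apply: KL; exact: mem_head.
  rewrite e2; have -> : cross (dir k.1) (scale s2 (dir i)) = - s2 * cross (dir i) (dir k.1).
    by rewrite /cross /scale /=; ring.
  by rewrite pmulr_lge0 // oppr_ge0.
have [[s0 s0_ge0 E12] _] := seg _ h2 p2_0.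
have ik : (i < k.1)%N.
  have /andP[ik _] : (i <= k.1 < i + n)%N.
    by apply: (allP sn); apply: map_f; apply: KL; exact: mem_head.
  rewrite ltn_neqAle ik andbT; apply/eqP => iE.
  move: k_ge0; rewrite /depth iE sd; last by apply: KL; exact: mem_head.
  rewrite -iE leqNgt ln /=.
  by have := mulr_gt0 delta_gt0 (len_gt0 i); lra.
have bn : (b.1 < i + n)%N.
  by have /andP[] := allP sn b.1 (map_f _ bs).
have st' : sorted ltn (tags (k :: K ++ [:: (b.1, p1); ((i + n)%N, p2)])).
  move: st; rewrite /s /tags !map_cat => /cat_sorted2[_].
  rewrite /= map_cat !cat_path /= bn andbT.
  by case/andP=> [-> /andP[-> _]].
split.
- exact: st'.
- apply/allP => j jt; apply/andP; split.
    move: jt; rewrite inE => /predU1P[->//|jt].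
    apply: ltn_trans ik _.
    exact: (allP (order_path_min ltn_trans st')).
  rewrite addSn ltnS; move: jt; rewrite -cat_cons /tags map_cat mem_cat => /orP[jK'|].
    have js : j \in tags s by rewrite /s /tags !map_cat !mem_cat jK' orbT.
    by have /andP[_ /ltnW] := allP sn j js.
  by rewrite !inE => /orP[/eqP ->|/eqP ->//]; apply: ltnW.
- have j1 : joined l (b.1, p1).
    apply/asboolP; split=> //; exists (t_1 * sb) => /=.
      by rewrite mulr_ge0 //; case/andP: t1.
    have -> : p1 - l.2 = scale t_1 (b.2 - l.2).
      by apply: point_eq; rewrite /p1 /cut -/t_1 /scale /=; ring.
    by rewrite Eb'; apply: point_eq; rewrite /scale /= mulrA.
  have j2 : joined (b.1, p1) ((i + n)%N, p2).
    apply/asboolP; rewrite dir_per; split; first by exists s0.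
    by move: cb; rewrite /cross; lra.
  have j3 : joined ((i + n)%N, p2) k.
    apply/asboolP; rewrite dir_per; split=> //; exists ((1 - t_2) * sa).
      by rewrite mulr_ge0 //; lra.
    have -> : k.2 - p2 = scale (1 - t_2) (k.2 - a.2).
      by apply: point_eq; rewrite /p2 /cut -/t_2 /scale /=; ring.
    by rewrite Ea'; apply: point_eq; rewrite /scale /= mulrA.
  by rewrite /= rcons_path cat_path last_cat /= -/l jK j1 j2 j3.
- move=> u; rewrite -cat_cons mem_cat => /orP[/KL/sd //|].
  rewrite !inE => /orP[/eqP ->|/eqP ->] /=.
    have -> : side b.1 p1 = side b.1 b.2 - cross (dir b.1) (b.2 - p1).
      by rewrite /side /cross /=; ring.
    by rewrite X1 subrr sd // /cross /= !mulr0 subrr subr0.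
  rewrite leq_addl side_per len_per; move: p2_0; rewrite /depth; lra.
move=> y; have newS : hull (k :: K ++ [:: (b.1, p1); ((i + n)%N, p2)]) `<=` hull s.
  apply: hull_sub; first exact: hull_convex.
  move=> u; rewrite -cat_cons mem_cat => /orP[/KL/hull_mem //|].
  by rewrite !inE => /orP[/eqP ->|/eqP ->].
split=> [hy|[Qy dy]].
  have /hs[Qy dy] := newS _ hy; split=> // j; rewrite ltnS leq_eqVlt => /predU1P[->|]; last exact: dy.
  apply: (hy _ (@depth_convex i 0)) => u /=.
  rewrite -cat_cons mem_cat => /orP[/K_ge0 //|].
  by rewrite !inE => /orP[/eqP ->|/eqP ->] /=; rewrite ?p1_0 ?p2_0.
set N := k :: K ++ _ in newS *.
have m1 : hull N p1 by apply: (@hull_mem N (b.1, p1)); rewrite /N -cat_cons mem_cat mem_head orbT.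
have m2 : hull N p2.
  by apply: (@hull_mem N ((i + n)%N, p2)); rewrite /N -cat_cons mem_cat !inE eqxx !orbT.
have segN z : hull s z -> depth i z = 0 -> hull N z.
  move=> hz z0; have [[s1 s1_ge0 e1] [s2 s2_le0 e2]] := seg _ hz z0.
  exact: between_sub (@hull_convex N) m1 m2 s1_ge0 s2_le0 e1 e2.
have hsy : hull s y by apply/hs; split=> // j ji; apply/dy/ltnW.
apply: (hull_clip _ segN hsy (dy i (ltnSn i))) => u us u0.
rewrite /N -cat_cons; apply: hull_mem.
by move: us; rewrite /s !mem_cat => /or3P[/A_lt0|->//|/B_lt0]; rewrite ltNge u0.
Qed.

(** * Nearest points of the inset *)

Lemma seq_mono (g : nat -> R) (a b : nat) : (a <= b)%N ->
  (forall l, (a <= l)%N -> (l < b)%N -> g l <= g l.+1) -> g a <= g b.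
Proof.
elim: b => [|b IH]; first by rewrite leqn0 => /eqP ->.
rewrite leq_eqVlt => /predU1P[->//|]; rewrite ltnS => ab H.
apply: le_trans (H b ab (ltnSn b)); apply: IH => // l al lb.
exact: H (ltnW lb : (l < b.+1)%N).
Qed.

Lemma seq_drop (g : nat -> R) (a b : nat) : (a <= b)%N -> g b < g a ->
  exists l, [/\ (a <= l)%N, (l < b)%N & g l.+1 < g l].
Proof.
move=> ab gba; apply: contrapT => H.
move: gba; rewrite ltNge => /negP; apply; apply: seq_mono => // l al lb.
by rewrite leNgt; apply/negP => gl; apply: H; exists l.
Qed.

Lemma cross_between j k l : 0 < cross (dir j) (dir k) -> (k <= j + n)%N ->
  (j < l)%N -> (l <= k)%N -> 0 < cross (dir j) (dir l).
Proof.
move=> cjk kn jl; rewrite leq_eqVlt => /predU1P[->//|lk].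
have kn' : (k < j + n)%N.
  rewrite ltn_neqAle kn andbT; apply/eqP => kE; move: cjk.
  by rewrite kE dir_per /cross mulrC subrr ltxx.
rewrite ltNge; apply/negP => /(cross_dir_sign jl lk kn') ckl.
by move: cjk; rewrite ltNge ltW.
Qed.

Lemma cross_between2 j k l m : 0 < cross (dir j) (dir k) -> (k <= j + n)%N ->
  (j < l)%N -> (l < m)%N -> (m <= k)%N -> 0 < cross (dir l) (dir m).
Proof.
move=> cjk kn jl lm mk; have cjm := cross_between cjk kn (ltn_trans jl lm) mk.
have mn : (m < j + n)%N.
  rewrite ltn_neqAle (leq_trans mk kn) andbT; apply/eqP => mE; move: cjm.
  by rewrite mE dir_per /cross mulrC subrr ltxx.
(* Seen from [m], the direction [j + n] is already past the half circle, hence so is the later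
   direction [l + n]. *)
have H1 : (j + n < l + n)%N by rewrite ltn_add2r.
have H2 : (l + n < m + n)%N by rewrite ltn_add2r.
have := cross_dir_sign mn H1 H2; rewrite !dir_per.
by move: cjm; rewrite /cross => cjm /(_ ltac:(lra)); lra.
Qed.

Definition inner x := forall i, 0 <= depth i x.

Definition touch i x : point := x + scale delta (normal i).

Lemma side_touch i x : depth i x = 0 -> side i (touch i x) = 0.
Proof. by rewrite /depth => d0; rewrite /touch side_normal. Qed.

Lemma side_touch_ge0 i j x : inner x -> 0 <= side j (touch i x).
Proof.
move=> /(_ j); rewrite /depth => d0.
have /side_lip -/(_ j) : enorm (touch i x - x) <= delta.
  by rewrite addrC addKr enorm_scale enorm_normal mulr1 gtr0_norm.
lra.
Qed.

Lemma dot_normal i j : dot (dir i) (normal j) = cross (dir i) (dir j) / len j.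
Proof. by rewrite /dot /normal /cross /=; ring. Qed.

Lemma dot_touch (D : point) i x : dot D (touch i x) = dot D x + delta * dot D (normal i).
Proof. by rewrite /dot /touch /scale /=; ring. Qed.

(** The touching point is on the line of edge [i] and on the inner side of edge [i.+1], so it cannot
    be beyond their common vertex. *)
Lemma touch_prev i x : inner x -> depth i x = 0 ->
  exists2 t, 0 <= t & touch i x = q i.+1 - scale t (dir i).
Proof.
move=> ix d0; have := side_touch d0; have := side_touch_ge0 i i.+1 ix.
rewrite /side; move: (touch i x) => T h c0.
have {}c0 : cross (dir i) (q i.+1 - T) = 0.
  by move: c0; rewrite /dir /cross /=; lra.
have := parallel (dot_dir_gt0 i) c0; set t := _ / _ => E.
exists t; last by rewrite -E opprB addrC subrK.
move: h; have -> : T - q i.+1 = - scale t (dir i) by rewrite -E opprB.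
have -> : cross (dir i.+1) (- scale t (dir i)) = t * cross (dir i) (dir i.+1).
  by rewrite /cross /scale /=; ring.
by rewrite pmulr_lge0 // cross_dirS.
Qed.

Lemma touch_next i x : inner x -> depth i.+1 x = 0 ->
  exists2 t, 0 <= t & touch i.+1 x = q i.+1 + scale t (dir i.+1).
Proof.
move=> ix d0; have := side_touch d0; have := side_touch_ge0 i.+1 i ix.
rewrite /side; move: (touch i.+1 x) => T h c0.
have := parallel (dot_dir_gt0 i.+1) c0; set t := _ / _ => E.
exists t; last by rewrite -E addrC subrK.
move: h; have -> : cross (dir i) (T - q i) = cross (dir i) (T - q i.+1).
  by rewrite /dir /cross /=; ring.
rewrite E; have -> : cross (dir i) (scale t (dir i.+1)) = t * cross (dir i) (dir i.+1).
  by rewrite /cross /scale /=; ring.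
by rewrite pmulr_lge0 // cross_dirS.
Qed.

Lemma dot_cross (a b c : point) :
  dot a c * cross a b = dot a b * cross a c - dot a a * cross b c.
Proof. by rewrite /dot /cross; ring. Qed.

(* [touch j x] and [touch k x] are the points of Q where the disk of radius
   [delta] around [x] meets the edges [j] and [k].  On the part of the boundary
   between them, the direction turns by less than a half circle, so a coordinate
   along [dir j] or [dir k] has no interior local minimum there. *)
Lemma corner_cone (j k c : nat) x : (j <= c)%N -> (c < k)%N -> (k <= j + n)%N ->
  0 < cross (dir j) (dir k) -> inner x -> depth j x = 0 -> depth k x = 0 ->
  0 <= dot (dir j) (q c.+1 - x) /\ dot (dir k) (q c.+1 - x) <= 0.
Proof.
move=> jc ck kn cjk ix dj dk.
have [s s0 Ej] := touch_prev ix dj.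
have [t t0 Ek] : exists2 t, 0 <= t & touch k x = q k + scale t (dir k).
  by case: k ck dk {kn cjk} => // k _; apply: touch_next.
have lj := len_gt0 j; have lk := len_gt0 k.
have nk : 0 < delta * dot (dir j) (normal k).
  by rewrite dot_normal mulr_gt0 // divr_gt0.
have nj : delta * dot (dir k) (normal j) < 0.
  rewrite dot_normal pmulr_rlt0 // pmulr_llt0 ?invr_gt0 //.
  by move: cjk; rewrite /cross; lra.
have dE (D : point) l : dot D (q l.+1) - dot D (q l) = dot D (dir l).
  by rewrite /dot /dir /=; ring.
have dB (D a b : point) : dot D (a - b) = dot D a - dot D b by rewrite /dot /=; ring.
have nn i : dot (dir i) (normal i) = 0.
  by rewrite dot_normal /cross [X in _ - X]mulrC subrr mul0r.
rewrite !dB; split.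
(* Otherwise some edge before [q c.+1] goes backwards along [dir j], and then so do all edges up to
   [k]. Hence [touch k x] would be behind [x], although it is [x] moved along [normal k], which
   points forwards. *)
- rewrite subr_ge0 leNgt; apply/negP => lt.
  have Tj : dot (dir j) x = dot (dir j) (q j.+1) - s * dot (dir j) (dir j).
    have := dot_touch (dir j) j x; rewrite nn mulr0 addr0 => <-; rewrite Ej.
    by rewrite /dot /scale /=; ring.
  have sd := mulr_ge0 s0 (dot_self_ge0 (dir j)).
  have [||l [jl lc]] := @seq_drop (fun l => dot (dir j) (q l)) j.+1 c.+1 => //; first lra.
  rewrite -subr_lt0 dE => hl.
  have desc m : (l < m)%N -> (m <= k)%N -> dot (dir j) (dir m) <= 0.
    move=> lm mk; have lk' : (l <= k)%N := ltnW (leq_trans lm mk).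
    have c1 := cross_between cjk kn jl lk'.
    have c2 := cross_between cjk kn (ltn_trans jl lm) mk.
    have c3 := cross_between2 cjk kn jl lm mk.
    rewrite -(pmulr_lle0 _ c1) dot_cross.
    have := mulr_le0_ge0 (ltW hl) (ltW c2).
    by have := mulr_ge0 (dot_self_ge0 (dir j)) (ltW c3); lra.
  have : - dot (dir j) (q c.+1) <= - dot (dir j) (q k).
    apply: (@seq_mono (fun l => - dot (dir j) (q l)) _ _ ck) => m cm mk.
    by have := desc m (leq_trans lc cm) (ltnW mk); rewrite -dE /=; lra.
  have := dot_touch (dir j) k x; rewrite Ek.
  have -> : dot (dir j) (q k + scale t (dir k)) =
     dot (dir j) (q k) + t * dot (dir j) (dir k) by rewrite /dot /scale /=; ring.
  have := mulr_ge0_le0 t0 (desc k (leq_trans lc ck) (leqnn k)).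
  lra.
(* The mirror image: an edge going backwards along [dir k] after [q c.+1] makes all edges from [j]
   up to it go backwards, against the position of [touch j x]. *)
- rewrite subr_le0 leNgt; apply/negP => lt.
  have Tk : dot (dir k) x = dot (dir k) (q k) + t * dot (dir k) (dir k).
    have := dot_touch (dir k) k x; rewrite nn mulr0 addr0 => <-; rewrite Ek.
    by rewrite /dot /scale /=; ring.
  have sd := mulr_ge0 t0 (dot_self_ge0 (dir k)).
  have [||l [cl lk']] := @seq_drop (fun l => dot (dir k) (q l)) c.+1 k => //; first lra.
  rewrite -subr_lt0 dE => hl.
  have neg m : (j <= m)%N -> (m <= l)%N -> cross (dir k) (dir m) < 0.
    rewrite leq_eqVlt => /predU1P[<-|jm] ml; first by move: cjk; rewrite /cross; lra.
    have := cross_between2 cjk kn jm (leq_ltn_trans ml lk') (leqnn k).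
    by rewrite /cross; lra.
  have desc m : (j <= m)%N -> (m < l)%N -> dot (dir k) (dir m) <= 0.
    move=> jm ml.
    have c1 := neg l (leq_trans jm (ltnW ml)) (leqnn l).
    have c2 := neg m jm (ltnW ml).
    have c3 : cross (dir l) (dir m) <= 0.
      suff : 0 < cross (dir m) (dir l) by rewrite /cross; lra.
      move: jm ml; rewrite leq_eqVlt => /predU1P[<-|jm] ml.
        exact: cross_between cjk kn ml (ltnW lk').
      exact: cross_between2 cjk kn jm ml (ltnW lk').
    rewrite -(nmulr_lge0 _ c1) dot_cross.
    have := mulr_le0 (ltW hl) (ltW c2).
    by have := mulr_ge0_le0 (dot_self_ge0 (dir k)) c3; lra.
  have : - dot (dir k) (q j.+1) <= - dot (dir k) (q c.+1).
    apply: (@seq_mono (fun l => - dot (dir k) (q l)) _ _ (jc : j < c.+1)%N) => m jm mc.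
    by have := desc m (ltnW jm) (leq_trans mc cl); rewrite -dE /=; lra.
  have := dot_touch (dir k) j x; rewrite Ej.
  have -> : dot (dir k) (q j.+1 - scale s (dir j)) =
     dot (dir k) (q j.+1) - s * dot (dir k) (dir j) by rewrite /dot /scale /=; ring.
  have := mulr_ge0_le0 s0 (desc j (leqnn j) (leq_ltn_trans jc cl)).
  lra.
Qed.

(** The two signs of [corner_cone] say that [q c.+1 - x] is normal at [x] to the wedge between the
    lines [j] and [k], which contains Pi. *)
Lemma corner_nearest (j k c : nat) x y : (j <= c)%N -> (c < k)%N -> (k <= j + n)%N ->
  0 < cross (dir j) (dir k) -> inner x -> depth j x = 0 -> depth k x = 0 ->
  inner y -> enorm (q c.+1 - x) <= enorm (q c.+1 - y).
Proof.
move=> jc ck kn cjk ix dj dk iy.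
have [hj hk] := corner_cone jc ck kn cjk ix dj dk.
have yj : 0 <= cross (dir j) (y - x) by have := depthD j x y; have := iy j; lra.
have yk : 0 <= cross (dir k) (y - x) by have := depthD k x y; have := iy k; lra.
have : cross (dir j) (dir k) * dot (q c.+1 - x) (y - x) =
  cross (dir j) (y - x) * dot (dir k) (q c.+1 - x)
   - cross (dir k) (y - x) * dot (dir j) (q c.+1 - x).
  by rewrite /cross /dot; ring.
have := mulr_ge0_le0 yj hk; have := mulr_ge0 yk hj.
set a := _ * _; set b := _ * _ => h1 h2 E.
have {E} d0 : dot (q c.+1 - x) (y - x) <= 0 by rewrite -(pmulr_rle0 _ cjk) E; lra.
rewrite enorm_le ?enorm_ge0 // sqr_enorm.
have := dot_self_ge0 (y - x); move: d0; rewrite /dot /=; nra.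
Qed.

(** Where a walk around Pi stands just before the side with index [m]. If no tag is below [m], the
    default [last] wraps around the cycle. *)
Definition out (s : seq item) (m : nat) : item :=
  last (last (0%N, q 0) s) [seq v <- s | (v.1 < m)%N].

Lemma filter_tags A v B : sorted ltn (tags (A ++ v :: B)) ->
  [seq w <- A ++ v :: B | (w.1 < v.1)%N] = A /\
  [seq w <- A ++ v :: B | (w.1 < v.1.+1)%N] = rcons A v.
Proof.
rewrite (sorted_pairwise ltn_trans) /tags map_cat pairwise_cat /= => /and4P[/allrelP Av _ vB _].
have Al w : w \in A -> (w.1 < v.1)%N.
  by move=> wA; apply: Av; [exact: map_f|exact: mem_head].
have Bg w : w \in B -> (v.1 < w.1)%N.
  by move=> wB; apply: (allP vB); apply: map_f.
rewrite !filter_cat /= ltnn ltnSn.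
have -> : [seq w <- A | (w.1 < v.1)%N] = A by apply/all_filterP/allP.
have -> : [seq w <- A | (w.1 < v.1.+1)%N] = A.
  by apply/all_filterP/allP => w /Al/leqW.
have -> : [seq w <- B | (w.1 < v.1)%N] = [::].
  rewrite -(filter_pred0 B); apply: eq_in_filter => w /Bg/ltnW.
  by rewrite leqNgt => /negbTE.
have -> : [seq w <- B | (w.1 < v.1.+1)%N] = [::].
  rewrite -(filter_pred0 B); apply: eq_in_filter => w /Bg.
  by rewrite ltnS ltnNge => /negbTE.
by rewrite cats0 cats1.
Qed.

Lemma filter_split m s : sorted ltn (tags s) ->
  s = [seq v <- s | (v.1 < m)%N] ++ [seq v <- s | ~~ (v.1 < m)%N].
Proof.
elim: s => //= u s IH su; have /IH {1}-> := path_sorted su.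
case: ifP => //= um; rewrite (_ : [seq v <- s | (v.1 < m)%N] = [::]) //.
rewrite -(filter_pred0 s); apply: eq_in_filter => v vs.
have := allP (order_path_min ltn_trans su) v.1 (map_f _ vs).
by move=> uv; apply: contraFF um => /(ltn_trans uv).
Qed.

Lemma innerP y : inner y <-> region y /\ forall j, (j < n)%N -> 0 <= depth j y.
Proof.
split=> [iy|[_ dy] i].
  split; last by move=> j _.
  apply/regionP => i; have := iy i; rewrite /depth.
  by have := mulr_gt0 delta_gt0 (len_gt0 i); lra.
have dE : depth i = depth (i %% n).
  rewrite {1}(divn_eq i n) addnC; elim: (i %/ n)%N => [|m IH]; rewrite ?addn0 //.
  by rewrite mulSn addnCA addnC depth_per.
by rewrite dE; apply: dy; rewrite ltn_mod; lia.
Qed.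

(** * Reading the vertices of Pi off the final deque *)

Section Output.
Variable s : seq item.
Hypothesis s_inv : clip_inv n s.
Hypothesis s_neq0 : s != [::].

Lemma out_mem m : out s m \in s.
Proof.
have := mem_last (last (0%N, q 0) s) [seq v <- s | (v.1 < m)%N].
rewrite inE -/(out s m) => /predU1P[->|]; last by rewrite mem_filter => /andP[].
by case: s s_neq0 => //= u s' _; apply: mem_last.
Qed.

Lemma path_joined : path joined (last (0%N, q 0) s) s.
Proof.
have [_ _ + _ _] := s_inv.
by case: s s_neq0 => //= u s' _; rewrite rcons_path andbC.
Qed.

Lemma out_tag v : v \in s -> out s v.1.+1 = v /\ joined (out s v.1) v.
Proof.
move=> vs; have pj := path_joined; have [st _ _ _ _] := s_inv.
rewrite /out; case/splitPr: vs pj st => A B pj /filter_tags[-> ->].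
rewrite last_rcons; split=> //.
by move: pj; rewrite cat_path /= => /and3P[_ -> _].
Qed.

Lemma out_notag m : (forall v, v \in s -> v.1 != m) -> out s m.+1 = out s m.
Proof.
move=> H; rewrite /out; congr last; apply: eq_in_filter => v /H vm.
by rewrite ltnS leq_eqVlt (negbTE vm).
Qed.

Lemma s_tags v : v \in s -> (n <= v.1 < n + n)%N.
Proof. by have [_ sn _ _ _] := s_inv => vs; apply: (allP sn); apply: map_f. Qed.

Lemma out_first : out s n = last (0%N, q 0) s.
Proof.
rewrite /out (_ : [seq v <- s | (v.1 < n)%N] = [::]) // -(filter_pred0 s).
by apply: eq_in_filter => v /s_tags/andP[nv _]; rewrite ltnNge nv.
Qed.

Lemma out_last : out s (n + n) = last (0%N, q 0) s.
Proof.
rewrite /out (_ : [seq v <- s | (v.1 < n + n)%N] = s); first by case: s s_neq0.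
by apply/all_filterP/allP => v /s_tags/andP[].
Qed.

Lemma hull_inner y : hull s y <-> inner y.
Proof. by have [_ _ _ _ hs] := s_inv; rewrite hs innerP. Qed.

(** One point per edge of Q rather than per side of Pi: an edge without a side repeats the current
    vertex, which [ccw_vertices] allows, and point [c] is then the one nearest to [q c.+1]. *)
Definition outv c : point := (out s (n + c).+1).2.

Lemma outv_inner c : inner (outv c).
Proof. by apply/hull_inner; exact: (hull_mem (out_mem _)). Qed.

Lemma polygon_outv : polygon (fun c : 'I_n => outv c) = [set y | inner y].
Proof.
apply/seteqP; split=> y.
  apply: polygon_min => [|c]; last exact: outv_inner.
  by move=> x z t t01 ix iz i; exact: (depth_convex t01 (ix i) (iz i)).
move=> /hull_inner; apply; first exact: polygon_convex.
move=> v vs; have /andP[nv vn] := s_tags vs.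
have cn : (v.1 - n < n)%N by lia.
have := polygon_vertex (fun c : 'I_n => outv c) (Ordinal cn).
by rewrite /outv /= subnKC // (out_tag vs).1.
Qed.

(** Either no side has the index [m] of the next edge and the two points coincide, or they span that
    side and [left_of] applies. At the end of the list, [out_first] and [out_last] identify the
    positions before and after a full turn. *)
Lemma outv_turn c k : (c < n)%N -> 0 <= orient (outv c) (outv (c.+1 %% n)) (outv k).
Proof.
move=> cn; pose m := (n + c.+1 %% n)%N.
have -> : outv c = (out s m).2.
  rewrite /outv /m; congr (_.2); have [cn'|cn'] := ltnP c.+1 n.
    by rewrite modn_small // addnS.
  have -> : c.+1 = n by lia.
  by rewrite modnn addn0 out_first -addnS (_ : c.+1 = n) ?out_last //; lia.
rewrite {1}/outv -/m.
have [[v vs vm]|none] := pselect (exists2 v, v \in s & v.1 = m); last first.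
  rewrite out_notag; first by rewrite /orient; lra.
  by move=> v vs; apply/eqP => vm; apply: none; exists v.
have [vE jv] := out_tag vs; rewrite -vm vE orientE.
have [st sn cs _ _] := s_inv.
have := left_of st sn cs vs (out_mem (n + k).+1); rewrite -/(outv k).
have [[t t0 E] _] : (exists2 t, 0 <= t & v.2 - (out s v.1).2 = scale t (dir v.1)) /\
    0 < cross (dir (out s v.1).1) (dir v.1) by exact/asboolP.
set u := (out s v.1).2 in E *; move=> h.
have -> : cross (v.2 - u) (outv k - u) = cross (v.2 - u) (outv k - v.2).
  by rewrite /cross /=; ring.
rewrite E; have -> : cross (scale t (dir v.1)) (outv k - v.2) =
   t * cross (dir v.1) (outv k - v.2) by rewrite /cross /scale /=; ring.
exact: mulr_ge0.
Qed.

Lemma depth_joined u v : u \in s -> v \in s -> joined u v ->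
  [/\ depth u.1 u.2 = 0, depth v.1 u.2 = 0 & 0 < cross (dir u.1) (dir v.1)].
Proof.
have [_ _ _ sd _] := s_inv => us vs juv.
have d0 w : w \in s -> depth w.1 w.2 = 0.
  by move=> ws; rewrite /depth sd //; have /andP[-> _] := s_tags ws; rewrite subrr.
split; first exact: d0.
  have [t _] := joined_depth v.1 juv; rewrite d0 //.
  by rewrite /cross [X in _ - X]mulrC subrr mulr0 addr0.
by case/asboolP: juv.
Qed.

(** The last and the first vertex are consecutive as well, once the first is moved one turn
    ahead. *)
Lemma wrap_nearest (c : nat) y (u := last (0%N, q 0) s) (h := head (0%N, q 0) s) :
  (u.1 <= c)%N -> (c < h.1 + n)%N -> inner y ->
  enorm (q c.+1 - u.2) <= enorm (q c.+1 - y).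
Proof.
move=> uc ch iy; have us : u \in s by rewrite /u; case: s s_neq0 => //= z s' _; exact: mem_last.
have hs : h \in s by rewrite /h; case: s s_neq0 => //= z s' _; exact: mem_head.
have juh : joined u h.
  by move: path_joined; rewrite /u /h; case: s s_neq0 => //= z s' _ /andP[].
have hu : (h.1 <= u.1)%N.
  have [st _ _ _ _] := s_inv; rewrite /u /h; case: s s_neq0 st => //= z s' _ st.
  have := mem_last z s'; rewrite inE => /predU1P[-> //|ls].
  exact: ltnW (allP (order_path_min ltn_trans st) _ (map_f _ ls)).
have [d1 d2 c0] := depth_joined us hs juh.
apply: (@corner_nearest u.1 (h.1 + n) c) => //; rewrite ?dir_per ?depth_per //.
  by rewrite leq_add2r.
by apply/hull_inner; exact: hull_mem us.
Qed.

Lemma outv_nearest c y : (c < n)%N -> inner y ->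
  enorm (q c.+1 - outv c) <= enorm (q c.+1 - y).
Proof.
move=> cn iy; have iv := outv_inner c.
have [st _ cs _ _] := s_inv; have pj := path_joined.
have qE k : q (k + (n + c).+1) = q (k + c.+1) by rewrite -addnS addnCA addnC q_per.
have sE := filter_split (n + c).+1 st.
move: iv; rewrite /outv /out.
set A := [seq v <- s | (v.1 < _)%N] in sE *; set B := [seq v <- s | _] in sE.
have mA a : a \in A -> a \in s /\ (a.1 <= n + c)%N.
  by rewrite mem_filter ltnS => /andP[].
have mB b : b \in B -> b \in s /\ (n + c < b.1)%N.
  by rewrite mem_filter -leqNgt => /andP[].
(* [A] has the tags up to [n + c] and [B] the later ones. If one is empty, the wrapping pair is
   responsible, with one more turn added to the index when it is [A]; otherwise the last of [A] and
   the first of [B] are. *)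
case: (lastP A) sE mA => [|A' a] sE mA; last case: B sE mB => [|b B'] sE mB.
- have hB : head (0%N, q 0) s \in B.
    by rewrite -[B]/([::] ++ B) -sE; case: s s_neq0 => //= z s' _; exact: mem_head.
  have := @wrap_nearest (n + (n + c)) y.
  rewrite -addnS qE [(n + c.+1)%N]addnC q_per /= => + iv; apply=> //.
    have /andP[_ un] : (n <= (last (0%N, q 0) s).1 < n + n)%N.
      by apply: s_tags; case: s s_neq0 => //= z s' _; exact: mem_last.
    by apply: leq_trans (ltnW un) _; rewrite addnA leq_addr.
  by have [_ ?] := mB _ hB; rewrite addnC ltn_add2r.
- rewrite cats0 in sE; rewrite last_rcons => iv.
  have lE : last (0%N, q 0) s = a by rewrite {1}sE last_rcons.
  have := @wrap_nearest (n + c) y; rewrite lE -(add0n (n + c).+1) qE add0n; apply=> //.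
    by have [] := mA a ltac:(by rewrite mem_rcons mem_head).
  have /andP[nh _] : (n <= (head (0%N, q 0) s).1 < n + n)%N.
    by apply: s_tags; case: s s_neq0 => //= z s' _; exact: mem_head.
  by rewrite addnC; apply: leq_trans (_ : n + n <= _)%N; rewrite ?leq_add2r // ltn_add2r.
rewrite last_rcons => iv.
have [as_ ac] := mA a ltac:(by rewrite mem_rcons mem_head).
have [bs bc] := mB b (mem_head _ _).
move: pj; rewrite {2}sE cat_path last_rcons /= => /and3P[_ jab _].
have [d1 d2 c0] := depth_joined as_ bs jab.
have := @corner_nearest a.1 b.1 (n + c) a.2 y ac bc.
rewrite -(add0n (n + c).+1) qE add0n; apply=> //.
have /andP[na _] := s_tags as_; have /andP[_ bn] := s_tags bs.
by apply: leq_trans (ltnW bn) _; rewrite leq_add2r.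
Qed.
End Output.

(** * The boundary of the offset *)

(** The normal cone at [q i.+1]. These cones and the outward strips [at_edge] sort the points
    outside Q by their nearest point of Q. *)
Definition at_vertex x i : Prop :=
  0 <= dot (dir i) (x - q i.+1) /\ dot (dir i.+1) (x - q i.+1) <= 0.

Definition at_edge x i : Prop := exists t rho,
  [/\ 0 <= t <= 1, 0 < rho & x = lerp (q i) (q i.+1) t + scale rho (normal i)].

Lemma at_edgeP x i : side i x < 0 -> 0 <= dot (dir i) (x - q i) ->
  dot (dir i) (x - q i.+1) <= 0 -> at_edge x i.
Proof.
move=> s0 t0 t1; have D0 := dot_dir_gt0 i; have l0 := len_gt0 i.
exists (dot (dir i) (x - q i) / dot (dir i) (dir i)), (- side i x / len i); split.
- rewrite divr_ge0 ?(ltW D0) //= ler_pdivrMr // mul1r.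
  by move: t1; rewrite {2}/dir /dot /=; lra.
- by rewrite divr_gt0 // oppr_gt0.
have L : len i * len i = dot (dir i) (dir i) by rewrite len_sqr.
have sc (a b : R) : a / len i * (b / len i) = a * b / dot (dir i) (dir i).
  by rewrite -L; field; rewrite gt_eqF.
have dn : dot (dir i) (dir i) != 0 by rewrite gt_eqF.
have E1 : dot (dir i) (x - q i) * (dir i).1 - side i x * (dir i).2 =
    dot (dir i) (dir i) * (x - q i).1 by rewrite /side /dot /cross; ring.
have E2 : dot (dir i) (x - q i) * (dir i).2 + side i x * (dir i).1 =
    dot (dir i) (dir i) * (x - q i).2 by rewrite /side /dot /cross; ring.
have X1 : x.1 = (q i).1 + (dot (dir i) (x - q i) / dot (dir i) (dir i) * (dir i).1 +
    - side i x / len i * ((dir i).2 / len i)).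
  by rewrite sc mulrAC -mulrDl mulNr E1 mulrAC divff // mul1r /= addrC subrK.
have X2 : x.2 = (q i).2 + (dot (dir i) (x - q i) / dot (dir i) (dir i) * (dir i).2 +
    - side i x / len i * (- (dir i).1 / len i)).
  by rewrite sc mulrAC -mulrDl mulrNN E2 mulrAC divff // mul1r /= addrC subrK.
by apply: point_eq; rewrite ?[LHS]X1 ?[LHS]X2 addrA.
Qed.

(** A point that sees edge [i] and projects beyond its end, but is not in the cone of that end, also
    sees the next edge; if it does not project into it, it again projects beyond its end. *)
Lemma walk_next x i : ~ at_vertex x i -> ~ at_edge x i.+1 ->
  side i x < 0 -> 0 < dot (dir i) (x - q i.+1) ->
  side i.+1 x < 0 /\ 0 < dot (dir i.+1) (x - q i.+2).
Proof.
move=> nv ne s0 d0.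
have d1 : 0 < dot (dir i.+1) (x - q i.+1).
  by rewrite ltNge; apply/negP => d1; apply: nv; split=> //; exact: ltW.
have s0' : cross (dir i) (x - q i.+1) < 0.
  by move: s0; rewrite /side /dir /cross /=; lra.
have s1 : side i.+1 x < 0.
  rewrite /side ltNge; apply/negP => s1.
  have E : cross (dir i) (dir i.+1) * dot (x - q i.+1) (x - q i.+1) =
    cross (dir i) (x - q i.+1) * dot (dir i.+1) (x - q i.+1)
     - cross (dir i.+1) (x - q i.+1) * dot (dir i) (x - q i.+1).
    by rewrite /cross /dot; ring.
  have := mulr_ge0 (ltW (cross_dirS i)) (dot_self_ge0 (x - q i.+1)).
  rewrite E; have := mulr_ge0 s1 (ltW d0).
  have : cross (dir i) (x - q i.+1) * dot (dir i.+1) (x - q i.+1) < 0.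
    by rewrite pmulr_llt0.
  lra.
split=> //; rewrite ltNge; apply/negP => d2; apply: ne.
exact: at_edgeP s1 (ltW d1) d2.
Qed.

Lemma walk_prev x i : ~ at_vertex x i -> ~ at_edge x i ->
  side i.+1 x < 0 -> dot (dir i.+1) (x - q i.+1) < 0 ->
  side i x < 0 /\ dot (dir i) (x - q i) < 0.
Proof.
move=> nv ne s1 d1.
have d0 : dot (dir i) (x - q i.+1) < 0.
  by rewrite ltNge; apply/negP => d0; apply: nv; split=> //; exact: ltW.
have sE : side i x = cross (dir i) (x - q i.+1) by rewrite /side /dir /cross /=; ring.
have s0 : side i x < 0.
  rewrite sE ltNge; apply/negP => s0.
  have E : cross (dir i) (dir i.+1) * dot (x - q i.+1) (x - q i.+1) =
    cross (dir i) (x - q i.+1) * dot (dir i.+1) (x - q i.+1)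
     - side i.+1 x * dot (dir i) (x - q i.+1).
    by rewrite /side /cross /dot; ring.
  have := mulr_ge0 (ltW (cross_dirS i)) (dot_self_ge0 (x - q i.+1)).
  rewrite E; have := mulr_ge0_le0 s0 (ltW d1).
  have : 0 < side i.+1 x * dot (dir i) (x - q i.+1) by rewrite nmulr_rgt0.
  lra.
split=> //; rewrite ltNge; apply/negP => d2; apply: ne.
exact: at_edgeP s0 d2 (ltW d0).
Qed.

(* The distance to the vertices decreases strictly as long as the walk along
   the edges visible from [x] goes on, so it cannot go around the polygon. *)
Lemma cover x : region x \/ exists i, at_vertex x i \/ at_edge x i.
Proof.
apply: contrapT => /not_orP[nx nc].
have nv i : ~ at_vertex x i by move=> h; apply: nc; exists i; left.
have ne i : ~ at_edge x i by move=> h; apply: nc; exists i; right.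
have [i si] : exists i, side i x < 0.
  apply: contrapT => H; apply: nx; apply/regionP => i.
  by rewrite leNgt; apply/negP => si; apply: H; exists i.
have [d0|d0] := ltP 0 (dot (dir i) (x - q i.+1)).
  have W k : side (i + k) x < 0 /\ 0 < dot (dir (i + k)) (x - q (i + k).+1).
    elim: k => [|k [IH1 IH2]]; rewrite ?addn0 // addnS.
    exact: walk_next (nv _) (ne _) IH1 IH2.
  pose g k := - dot (x - q (i + k)) (x - q (i + k)).
  have gS k : g k < g k.+1.
    have [_] := W k; have := dot_dir_gt0 (i + k); rewrite /g addnS.
    by rewrite /dot /dir /=; nra.
  have := gS 0%N; rewrite ltNge => /negP; apply.
  have := @seq_mono g 1 n _ _; rewrite /g q_per addn0; apply; first by lia.
  by move=> l _ _; apply/ltW/gS.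
have [d1|d1] := leP 0 (dot (dir i) (x - q i)); first exact: ne (at_edgeP si d1 d0).
have W k : (k <= n)%N -> side (i + n - k) x < 0 /\ dot (dir (i + n - k)) (x - q (i + n - k)) < 0.
  elim: k => [_|k IH kn]; first by rewrite subn0 side_per dir_per q_per.
  have [] := IH (ltnW kn); have -> : (i + n - k = (i + n - k.+1).+1)%N by lia.
  exact: walk_prev.
pose g k := dot (x - q (i + k)) (x - q (i + k)).
have gS k : (k <= n)%N -> g k < g k.+1.
  move=> kn; have [_] := W (n - k)%N (leq_subr _ _); have := dot_dir_gt0 (i + k).
  have -> : (i + n - (n - k) = i + k)%N by lia.
  by rewrite /g addnS /dot /dir /=; nra.
have := gS 0%N isT; rewrite ltNge => /negP; apply.
have := @seq_mono g 1 n _ _; rewrite /g q_per addn0; apply; first by lia.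
by move=> l _ ln; apply/ltW/gS/ltnW.
Qed.

Lemma enorm_triangle x y : enorm (x + y) <= enorm x + enorm y.
Proof.
rewrite enorm_le ?addr_ge0 ?enorm_ge0 //.
have := dot_le_enorm x y; have := sqr_enorm x; have := sqr_enorm y.
rewrite /dot /=; nra.
Qed.

(** Library balls are squares here; 2 bounds the square root of 2. *)
Lemma ball_enorm x y (e : R) : ball x e y -> enorm (y - x) <= 2 * e.
Proof.
move=> [] /= + +; rewrite /ball /= => h1 h2.
have e0 : 0 < e by apply: le_lt_trans h1; exact: normr_ge0.
rewrite enorm_le ?mulr_ge0 ?(ltW e0) // /dot /=.
move: h1 h2; rewrite !ltr_norml => /andP[h1 h2] /andP[h3 h4].
nra.
Qed.

Lemma enorm_ball x y (e : R) : enorm (y - x) < e -> ball x e y.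
Proof.
move=> h; have e0 : 0 < e := le_lt_trans (enorm_ge0 _) h.
move: h; rewrite enorm_lt ?(ltW e0) // /dot /= => h.
have sq (a : R) : a * a < e ^+ 2 -> `|a| < e.
  move=> ae; rewrite -(ltr_pXn2r (ltn0Sn 1)) ?nnegrE ?(ltW e0) //.
  by rewrite -normrX ger0_norm ?sqr_ge0.
have s1 := sqr_ge0 (y.1 - x.1); have s2 := sqr_ge0 (y.2 - x.2).
by split; rewrite /ball /= distrC; apply: sq; move: h s1 s2; rewrite !expr2; lra.
Qed.

Definition normal_at (p u : point) : Prop :=
  region p /\ forall z, region z -> dot u (z - p) <= 0.

(** The nearest point of Q to [p + u] is [p]. If [u] is longer than [eps], the half-plane supporting
    the offset keeps a neighbourhood away; if shorter, a neighbourhood stays within [eps] of [p]; if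
    equal, any push along [u] leaves that half-plane. *)
Lemma boundary_offset eps p u : 0 < eps -> normal_at p u ->
  boundary (offset region eps) (p + u) <-> enorm u = eps.
Proof.
move=> eps0 [Qp up]; set A := offset region eps.
have uu := sqr_enorm u; have u0 := enorm_ge0 u.
have supp y : A y -> dot u (y - p) <= eps * enorm u.
  move=> /offsetP[z Qz hz]; have -> : y - p = (y - z) + (z - p) by rewrite addrA subrK.
  have -> : dot u (y - z + (z - p)) = dot u (y - z) + dot u (z - p).
    by rewrite /dot /=; ring.
  have := up z Qz; have := dot_le_enorm u (y - z).
  have := ler_wpM2l u0 hz; lra.
have pu y : y - p = u + (y - (p + u)) by rewrite opprD addrA addrC !addrA subrK addrC.
split=> [[clx nix]|uE].
  apply/eqP; rewrite eq_le; apply/andP; split; rewrite leNgt; apply/negP => lt.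
    pose e := (enorm u - eps) / 4.
    have e0 : 0 < e by rewrite /e; lra.
    have [y [Ay /ball_enorm hy]] := clx _ (nbhsx_ballx (p + u) e e0).
    have := supp y Ay; rewrite pu.
    have -> : dot u (u + (y - (p + u))) = dot u u + dot u (y - (p + u)).
      by rewrite /dot /=; ring.
    have := dot_le_enorm (- u) (y - (p + u)); rewrite enormN.
    have -> : dot (- u) (y - (p + u)) = - dot u (y - (p + u)) by rewrite /dot /=; ring.
    have := ler_wpM2l u0 hy; have u_gt0 : 0 < enorm u by lra.
    have : 0 < enorm u * e by rewrite mulr_gt0.
    rewrite -uu /e; nra.
  apply: nix; pose e := (eps - enorm u) / 2.
  have e0 : 0 < e by rewrite /e; lra.
  rewrite /interior /=; apply/nbhs_ballP; exists e => // y /ball_enorm hy.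
  apply/offsetP; exists p => //; rewrite pu.
  by apply: le_trans (enorm_triangle _ _) _; move: hy; rewrite /e; lra.
have Ax : A (p + u) by apply/offsetP; exists p => //; rewrite addrC addKr uE.
split; first exact: subset_closure.
rewrite /interior => /nbhs_ballP[e /= e0 he].
pose t := e / (2 * eps).
have t0 : 0 < t by rewrite divr_gt0 // mulr_gt0.
have /he/supp : ball (p + u) e (p + u + scale t u).
  apply: enorm_ball; rewrite addrC addKr enorm_scale uE gtr0_norm //.
  have -> : t * eps = e / 2 by rewrite /t; field; rewrite gt_eqF.
  lra.
have -> : p + u + scale t u - p = u + scale t u by rewrite addrC !addrA addNr add0r.
have -> : dot u (u + scale t u) = (1 + t) * dot u u by rewrite /dot /scale /=; ring.
rewrite -uu uE; have := mulr_gt0 t0 (mulr_gt0 eps0 eps0); nra.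
Qed.

Lemma at_vertex_normal x i : at_vertex x i -> normal_at (q i.+1) (x - q i.+1).
Proof.
move=> [h1 h2]; split=> [|z /regionP Qz]; first exact: region_vertex.
have z1 : 0 <= cross (dir i) (z - q i.+1).
  by have := Qz i; rewrite /side /dir /cross /=; lra.
have z2 := Qz i.+1; rewrite /side in z2.
rewrite -(pmulr_rle0 _ (cross_dirS i)).
have -> : cross (dir i) (dir i.+1) * dot (x - q i.+1) (z - q i.+1) =
  cross (dir i) (z - q i.+1) * dot (dir i.+1) (x - q i.+1)
   - cross (dir i.+1) (z - q i.+1) * dot (dir i) (x - q i.+1).
  by rewrite /cross /dot; ring.
have := mulr_ge0_le0 z1 h2; have := mulr_ge0 z2 h1; lra.
Qed.

Lemma edge_normal i t rho : 0 <= t <= 1 -> 0 <= rho ->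
  normal_at (lerp (q i) (q i.+1) t) (scale rho (normal i)).
Proof.
move=> t01 rho0; split=> [|z /regionP/(_ i)].
  by apply: polygon_convex => //; exact: region_vertex.
have -> : side i z = cross (dir i) (z - lerp (q i) (q i.+1) t).
  by rewrite /side /dir /cross /lerp /=; ring.
set w := z - _ => w0.
have -> : dot (scale rho (normal i)) w = - (rho * (cross (dir i) w / len i)).
  by rewrite /dot /scale /normal /cross /=; ring.
by rewrite oppr_le0 mulr_ge0 // divr_ge0 // ltW ?len_gt0.
Qed.

(** A quarter turn converts orientations against the normals, which delimit the arc, into scalar
    products with the edge directions, which delimit the cone. *)
Lemma arcP eps i x : 0 < eps ->
  Defs.arc (q i.+1) (q i.+1 + scale eps (normal i)) (q i.+1 + scale eps (normal i.+1)) x <->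
  enorm (x - q i.+1) = eps /\ at_vertex x i.
Proof.
move=> e0.
have nE : enorm (q i.+1 + scale eps (normal i) - q i.+1) = eps.
  by rewrite addrC addKr enorm_scale enorm_normal mulr1 gtr0_norm.
have o1 : orient (q i.+1) (q i.+1 + scale eps (normal i)) x =
    eps / len i * dot (dir i) (x - q i.+1).
  by rewrite orientE addrC addKr /cross /scale /normal /dot /=; ring.
have o2 : orient (q i.+1) x (q i.+1 + scale eps (normal i.+1)) =
    eps / len i.+1 * - dot (dir i.+1) (x - q i.+1).
  by rewrite orientE [_ + scale _ _]addrC addrK /cross /scale /normal /dot /=; ring.
have p1 : 0 < eps / len i by rewrite divr_gt0 ?len_gt0.
have p2 : 0 < eps / len i.+1 by rewrite divr_gt0 ?len_gt0.
rewrite /Defs.arc /at_vertex /= o1 o2 nE !pmulr_rge0 // oppr_ge0.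
by split=> [[-> ? ?]|[-> [? ?]]].
Qed.

Lemma segmentP eps i x :
  segment (q i + scale eps (normal i)) (q i.+1 + scale eps (normal i)) x <->
  exists2 t, 0 <= t <= 1 & x = lerp (q i) (q i.+1) t + scale eps (normal i).
Proof.
split=> -[t t01 ->]; exists t => //; apply: point_eq; rewrite /lerp /scale /=; ring.
Qed.

Lemma boundary_offsetE eps : 0 < eps ->
  boundary (offset region eps) = [set x | exists i,
    Defs.arc (q i.+1) (q i.+1 + scale eps (normal i)) (q i.+1 + scale eps (normal i.+1)) x \/
    segment (q i + scale eps (normal i)) (q i.+1 + scale eps (normal i)) x].
Proof.
move=> e0; apply/seteqP; split=> x.
  move=> bx; have [Qx|[i [vx|[t [rho [t01 rho0 xE]]]]]] := cover x.
  (* Points of Q are excluded from the boundary by taking the zero normal vector, whose length is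
     not [eps]. *)
  - have n0 : normal_at x 0.
      by split=> // z _; rewrite /dot /= !mul0r addr0.
    move: bx; rewrite -[x]addr0 boundary_offset // /enorm /= expr2 mul0r !addr0 sqrtr0 => e00.
    by move: e0; rewrite -e00 ltxx.
  - exists i; left; apply/arcP => //; split=> //.
    move: bx; rewrite -[x in boundary _ x](subrK (q i.+1)) addrC.
    by rewrite boundary_offset //; exact: at_vertex_normal.
  - exists i; right; apply/segmentP; exists t => //.
    move: bx; rewrite xE boundary_offset //; last exact: edge_normal t01 (ltW rho0).
    by rewrite enorm_scale enorm_normal mulr1 gtr0_norm // => ->.
move=> [i [/(arcP _ _ e0)[xe vx]|/segmentP[t t01 ->]]].
  rewrite -[x](subrK (q i.+1)) addrC boundary_offset //.
  exact: at_vertex_normal.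
rewrite boundary_offset //; last exact: edge_normal t01 (ltW e0).
by rewrite enorm_scale enorm_normal mulr1 gtr0_norm.
Qed.

(** * The programs *)

Lemma per_mod (T : Type) (g : nat -> T) k : (forall i, g (i + n)%N = g i) -> g (k %% n)%N = g k.
Proof.
move=> per; rewrite {2}(divn_eq k n) addnC.
by elim: (k %/ n)%N => [|m IH]; rewrite ?addn0 // mulSn addnCA addnC per.
Qed.

Lemma normal_per i : normal (i + n) = normal i.
Proof. by rewrite /normal dir_per len_per. Qed.

(** The range includes [k = n]: the first program copies [q 0] behind the last vertex, so that
    reading the successor never wraps around. *)
Definition holds_input r eps (s : state R) : Prop :=
  [/\ wmem s 0 0 = n, rmem s 0 0 = r, rmem s 0 1 = eps &
      forall k, (k <= n)%N -> (rmem s 1 k, rmem s 2 k) = q k].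

(* Besides the cells fixed by [input], [stores_offset] and [stores_polygon], the
   word arrays 1, 2, 3, 4 hold the loop index, the two ends of the deque and the
   edge indices of its vertices; the real arrays 11-12 hold the vertices of the
   deque, 13-16 the current edge vector, its length and the constant of the
   clipping line, 17-18 a current point, 19 a ratio and 20 [delta]. *)
Definition edge_vector : seq cmd :=
  [:: CSetR 13 (WConst 0) (RSub (RGet 1 (WAdd (wvar 1) (WConst 1))) (RGet 1 (wvar 1)));
      CSetR 14 (WConst 0) (RSub (RGet 2 (WAdd (wvar 1) (WConst 1))) (RGet 2 (wvar 1)));
      CSetR 15 (WConst 0)
        (RSqrt (RAdd (RMul (rvar 13) (rvar 13)) (RMul (rvar 14) (rvar 14))))].

(** The shifted edge [i] joins the end of arc [i] to the start of arc [i + 1]. The start of arc 0 is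
    therefore written to cell [n] and copied back after the loop. *)
Definition offset_body : cmd :=
  block (edge_vector ++ [::
    CSetR 17 (WConst 0) (RMul (RGet 0 (WConst 1)) (RDiv (rvar 14) (rvar 15)));
    CSetR 18 (WConst 0)
      (RMul (RGet 0 (WConst 1)) (RDiv (RSub (RConst 0) (rvar 13)) (rvar 15)));
    CSetR 3 (wvar 1) (RGet 1 (wvar 1));
    CSetR 4 (wvar 1) (RGet 2 (wvar 1));
    CSetR 7 (wvar 1) (RAdd (RGet 1 (wvar 1)) (rvar 17));
    CSetR 8 (wvar 1) (RAdd (RGet 2 (wvar 1)) (rvar 18));
    CSetR 5 (WAdd (wvar 1) (WConst 1)) (RAdd (RGet 1 (WAdd (wvar 1) (WConst 1))) (rvar 17));
    CSetR 6 (WAdd (wvar 1) (WConst 1)) (RAdd (RGet 2 (WAdd (wvar 1) (WConst 1))) (rvar 18));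
    incr 1]).

Definition offset_program : cmd :=
  block [:: CSetR 1 input_size (RGet 1 (WConst 0));
            CSetR 2 input_size (RGet 2 (WConst 0));
            CSetW 0 (WConst 1) input_size;
            for_each_edge offset_body;
            CSetR 5 (WConst 0) (RGet 5 input_size);
            CSetR 6 (WConst 0) (RGet 6 input_size)].

Lemma qcell s k r eps : holds_input r eps s -> (k <= n)%N ->
  rmem s 1 k = (q k).1 /\ rmem s 2 k = (q k).2.
Proof. by move=> [_ _ _ H] kn; rewrite -(H k kn). Qed.

Lemma len_eval i (x y : R) : x = (q i.+1).1 - (q i).1 -> y = (q i.+1).2 - (q i).2 ->
  Num.sqrt (x * x + y * y) = len i.
Proof. by move=> -> ->; rewrite /len /enorm /dir /= !expr2. Qed.

Definition chain_upto eps i (s : state R) : Prop := forall k, (k < i)%N ->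
  [/\ (rmem s 3 k, rmem s 4 k) = q k,
      (rmem s 7 k, rmem s 8 k) = q k + scale eps (normal k) &
      (rmem s 5 k.+1, rmem s 6 k.+1) = q k.+1 + scale eps (normal k)].

Lemma offset_body_correct r eps i s1 : (i < n)%N ->
  holds_input r eps s1 -> wmem s1 0 1 = n -> chain_upto eps i s1 -> wmem s1 1 0 = i ->
  ends offset_body s1 (fun t s2 => [/\ holds_input r eps s2 /\ wmem s2 0 1 = n,
    chain_upto eps i.+1 s2, wmem s2 1 0 = i.+1 & (t <= 150)%N]).
Proof.
move=> ltin hi m1 ch iE; have [h0 h1 h2 h3] := hi.
have [x0 y0] := qcell hi (ltnW ltin); have [x1 y1] := qcell hi ltin.
rewrite /offset_body /edge_vector /block /= /wvar.
apply: ends_setr => ? v; rewrite /upd /= iE addn1 x0 x1 => -> Ev.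
apply: ends_setr => ? v1; rewrite /upd /= iE addn1 y0 y1 => -> Ev1.
apply: ends_setr => ? v2; rewrite /upd /= (len_eval Ev Ev1) => -> Ev2.
apply: ends_setr => ? v3; rewrite /= /upd /= => -> Ev3.
apply: ends_setr => ? v4; rewrite /= /upd /= => -> Ev4.
apply: ends_setr => ? v5; rewrite /= /upd /= iE => -> Ev5.
apply: ends_setr => ? v6; rewrite /= /upd /= iE => -> Ev6.
apply: ends_setr => ? v7; rewrite /= /upd /= iE => -> Ev7.
apply: ends_setr => ? v8; rewrite /= /upd /= iE => -> Ev8.
apply: ends_setr => ? v9; rewrite /= /upd /= iE addn1 => -> Ev9.
apply: ends_setr => ? v10; rewrite /= /upd /= iE addn1 => -> Ev10.
apply: ends_setw => ? v11; rewrite /= /upd /= iE addn1 => -> Ev11.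
apply: ends_skip; split=> //=.
move=> k; rewrite ltnS leq_eqVlt /= => /predU1P[->|ki].
  rewrite !eqxx Ev5 Ev6 Ev7 Ev8 Ev9 Ev10 Ev3 Ev4 x0 y0 x1 y1 h2 Ev2 Ev Ev1 sub0r.
  split; [by apply: point_eq|exact: point_eq|exact: point_eq].
by rewrite eqSS !(ltn_eqF ki); exact: ch.
Qed.

Lemma chain_boundary eps (c a b : 'I_n -> point) : 0 < eps ->
  (forall i : 'I_n, c i = q i) -> (forall i : 'I_n, b i = q i + scale eps (normal i)) ->
  (forall i : 'I_n, a (ordS i) = q i.+1 + scale eps (normal i)) ->
  boundary (offset region eps) = arc_chain c a b.
Proof.
move=> e0 cE bE aE; rewrite boundary_offsetE //; apply/seteqP.
have n0 : (0 < n)%N by lia.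
have ordS_val (i : 'I_n) : nat_of_ord (ordS i) = (i.+1 %% n)%N by [].
have bS (i : 'I_n) : b (ordS i) = q i.+1 + scale eps (normal i.+1).
  by rewrite bE ordS_val q_mod (per_mod _ normal_per).
have cS (i : 'I_n) : c (ordS i) = q i.+1 by rewrite cE ordS_val q_mod.
split=> x.
  move=> [i].
  (* The pieces are periodic, so their natural index can be reduced modulo [n]. *)
  pose F k := Defs.arc (q k.+1) (q k.+1 + scale eps (normal k))
                       (q k.+1 + scale eps (normal k.+1)).
  pose G k := segment (q k + scale eps (normal k)) (q k.+1 + scale eps (normal k)).
  have Fp k : F (k + n)%N = F k by rewrite /F -addSn !q_per !normal_per.
  have Gp k : G (k + n)%N = G k by rewrite /G -addSn !q_per !normal_per.
  rewrite -[Defs.arc _ _ _]/(F i) -[segment _ _]/(G i) -(per_mod i Fp) -(per_mod i Gp).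
  pose j := Ordinal (ltn_pmod i n0) : 'I_n.
  rewrite -[(i %% n)%N]/(nat_of_ord j) => -[Fx|Gx].
    by exists (ordS j) => //; left; rewrite cS aE bS.
  by exists j => //; right; rewrite bE aE.
move=> [i _ [ax|sx]].
  exists (ord_pred i); left; move: ax; rewrite -{1 2 3}(ord_predK i).
  by rewrite cS aE bS.
by exists i; right; move: sx; rewrite bE aE.
Qed.

Lemma offset_program_correct r eps s : 0 < eps ->
  wmem s 0 0 = n -> rmem s 0 0 = r -> rmem s 0 1 = eps ->
  (forall k, (k < n)%N -> (rmem s 1 k, rmem s 2 k) = q k) ->
  ends offset_program s (fun t s' => [/\ holds_input r eps s',
    stores_offset s' (offset region eps) & (t <= 200 * n + 200)%N]).
Proof.
move=> e0 h0 hr he hq; rewrite /offset_program /block /= /input_size.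
have n0 : (0 < n)%N by lia.
have qn : q n = q 0%N by rewrite -[n in q n]add0n q_per.
have q0 := hq 0%N n0.
apply: ends_setr => ? v; rewrite /= h0 => -> Ev.
apply: ends_setr => ? v'; rewrite /= /upd /= h0 => -> Ev'.
apply: ends_setw => ? v''; rewrite /= /upd /= => -> ->.
apply: ends_seq.
pose I i s' := [/\ holds_input r eps s', wmem s' 0 1 = n & chain_upto eps i s'].
apply: (@ends_for _ _ _ n 150 I (fun=> 0%N)) => //=.
- move=> s1 fw fr; split=> //; rewrite /I /holds_input !fw //= fr /= !h0 hr he; split=> //.
  split=> // k kn; have [->|kn'] := eqVneq k n; first by rewrite Ev Ev' qn -q0.
  by apply: hq; rewrite ltn_neqAle kn' kn.
- move=> i s1 ltin [hi m1 ch] iE nE.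
  apply: ends_weak (offset_body_correct ltin hi m1 ch iE) _ => t s2 [[hi2 m2] ch2 iE2 tb].
  by split=> //; [have [] := hi2|lia].
move=> t s1 [hi m1 ch] nE tb.
apply: ends_setr => ? w; rewrite /= nE => -> Ew.
apply: ends_setr => ? w'; rewrite /= /upd /= nE => -> Ew'.
apply: ends_skip; split.
- by have [? ? ? ?] := hi; split.
- rewrite /stores_offset /= m1.
  apply: chain_boundary => // i; have [C B A] := ch i (ltn_ord i).
  + by rewrite /points /= C.
  + by rewrite /points /= B.
  + rewrite /points /=; have [iS|iS] := ltnP i.+1 n.
      by rewrite modn_small //= A.
    have iE : i.+1 = n by apply/eqP; rewrite eqn_leq iS ltn_ord.
    by move: A; rewrite iE modnn /= Ew Ew' => ->.
- by move: tb; rewrite /=; lia.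
Qed.

(** * The clipping program *)

Definition depth_at (x y : rexp) : rexp :=
  RSub (RSub (RMul (rvar 13) y) (RMul (rvar 14) x)) (rvar 16).
Definition depth_cell (w : wexp) : rexp := depth_at (RGet 11 w) (RGet 12 w).
Definition is_neg (e : rexp) : bexp := BLtR e (RConst 0).
Definition back : wexp := WSub (wvar 3) (WConst 1).
Definition nonempty : bexp := BLtW (wvar 2) (wvar 3).

Definition set_line : cmd :=
  block (edge_vector ++ [::
    CSetR 16 (WConst 0)
      (RAdd (RSub (RMul (rvar 13) (RGet 2 (wvar 1))) (RMul (rvar 14) (RGet 1 (wvar 1))))
            (RMul (rvar 20) (rvar 15)))]).

(* [pop_front] leaves the last vertex popped, if any, in the arrays 17-18. *)
Definition pop_front : cmd :=
  CWhile (BAnd nonempty (is_neg (depth_cell (wvar 2))))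
    (block [:: CSetR 17 (WConst 0) (RGet 11 (wvar 2));
               CSetR 18 (WConst 0) (RGet 12 (wvar 2)); incr 2]).

(** No test for emptiness: [pop_front] has left a vertex of nonnegative depth at the front, which
    stops the loop. *)
Definition pop_back : cmd :=
  CWhile (is_neg (depth_cell back)) (block [:: CSetW 3 (WConst 0) back]).

(** The vertex popped last at the back is still in the cell just past the end. The first cut reads
    it there and overwrites its coordinates, while its tag stays in place for the new vertex. *)
Definition push : cmd :=
  block [::
    CSetR 19 (WConst 0) (RDiv (depth_cell back) (RSub (depth_cell back) (depth_cell (wvar 3))));
    CSetR 11 (wvar 3)
      (RAdd (RGet 11 back) (RMul (rvar 19) (RSub (RGet 11 (wvar 3)) (RGet 11 back))));
    CSetR 12 (wvar 3)
      (RAdd (RGet 12 back) (RMul (rvar 19) (RSub (RGet 12 (wvar 3)) (RGet 12 back))));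
    CSetR 19 (WConst 0)
      (RDiv (depth_at (rvar 17) (rvar 18))
            (RSub (depth_at (rvar 17) (rvar 18)) (depth_cell (wvar 2))));
    CSetR 11 (WAdd (wvar 3) (WConst 1))
      (RAdd (rvar 17) (RMul (rvar 19) (RSub (RGet 11 (wvar 2)) (rvar 17))));
    CSetR 12 (WAdd (wvar 3) (WConst 1))
      (RAdd (rvar 18) (RMul (rvar 19) (RSub (RGet 12 (wvar 2)) (rvar 18))));
    CSetW 4 (WAdd (wvar 3) (WConst 1)) (WAdd (wvar 1) input_size);
    CSetW 3 (WConst 0) (WAdd (wvar 3) (WConst 2))].

(** Quantified over all points, so that it serves both the cells of the deque and the point in the
    arrays 17-18. *)
Definition line i (s : state R) : Prop := forall x,
  rmem s 13 0 * x.2 - rmem s 14 0 * x.1 - rmem s 16 0 = depth i x.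

Definition item_at (s : state R) k : item := (wmem s 4 k, (rmem s 11 k, rmem s 12 k)).

Definition deque (s : state R) lo hi : seq item := [seq item_at s k | k <- iota lo (hi - lo)].

Lemma deque_cat s lo m hi : (lo <= m)%N -> (m <= hi)%N ->
  deque s lo hi = deque s lo m ++ deque s m hi.
Proof.
move=> lm mh; rewrite /deque -map_cat; congr map.
by rewrite -{2}(subnKC lm) -iotaD; congr iota; lia.
Qed.

Lemma deque_cons s lo hi : (lo < hi)%N -> deque s lo hi = item_at s lo :: deque s lo.+1 hi.
Proof. by move=> lh; rewrite /deque -{1}(subnSK lh). Qed.

Lemma deque_rcons s lo hi : (lo < hi)%N ->
  deque s lo hi = rcons (deque s lo hi.-1) (item_at s hi.-1).
Proof.
move=> lh; rewrite (@deque_cat s lo hi.-1 hi); [|lia|lia].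
rewrite (@deque_cons s hi.-1 hi); last lia.
by rewrite prednK ?(leq_ltn_trans _ lh) // /deque subnn cats1.
Qed.

Lemma last_deque s lo hi u : (lo < hi)%N -> last u (deque s lo hi) = item_at s hi.-1.
Proof. by move=> lh; rewrite deque_rcons // last_rcons. Qed.

Lemma mem_deque s lo hi u : u \in deque s lo hi ->
  exists k, [/\ (lo <= k)%N, (k < hi)%N & u = item_at s k].
Proof. by move=> /mapP[k]; rewrite mem_iota => /andP[lk kh] ->; exists k; split=> //; lia. Qed.

Lemma deque_ext s s' lo hi :
  (forall k, (lo <= k)%N -> (k < hi)%N -> item_at s' k = item_at s k) ->
  deque s' lo hi = deque s lo hi.
Proof. by move=> H; apply/eq_in_map => k; rewrite mem_iota => /andP[? ?]; apply: H; lia. Qed.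

Lemma deque_nil s lo : deque s lo lo = [::].
Proof. by rewrite /deque subnn. Qed.

Lemma set_line_correct i s r eps : (i < n)%N -> holds_input r eps s ->
  rmem s 20 0 = delta -> wmem s 1 0 = i ->
  ends set_line s (fun t s' => line i s' /\ (t <= 60)%N).
Proof.
move=> ltin hi d0 iE; have [h0 h1 h2 h3] := hi.
have [x0 y0] := qcell hi (ltnW ltin); have [x1 y1] := qcell hi ltin.
rewrite /set_line /edge_vector /block /= /wvar.
apply: ends_setr => ? v; rewrite /upd /= iE addn1 x0 x1 => -> Ev.
apply: ends_setr => ? v1; rewrite /upd /= iE addn1 y0 y1 => -> Ev1.
apply: ends_setr => ? v2; rewrite /upd /= (len_eval Ev Ev1) => -> Ev2.
apply: ends_setr => ? v3; rewrite /= /upd /= iE x0 y0 d0 => -> Ev3.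
apply: ends_skip; split=> //= x /=.
by rewrite Ev3 Ev2 Ev Ev1 /depth /side /cross /dir /=; ring.
Qed.

Lemma pop_front_correct i s lo hi : line i s -> wmem s 2 0 = lo -> wmem s 3 0 = hi ->
  (lo <= hi)%N ->
  ends pop_front s (fun t s' => exists lo',
    [/\ (lo <= lo' <= hi)%N /\ wmem s' 2 0 = lo',
        forall k, (lo <= k)%N -> (k < lo')%N -> depth i (item_at s k).2 < 0,
        (lo' < hi)%N -> 0 <= depth i (item_at s lo').2,
        (rmem s' 17 0, rmem s' 18 0) =
          if (lo < lo')%N then (item_at s lo'.-1).2 else (rmem s 17 0, rmem s 18 0) &
        (t <= 60 * (lo' - lo) + 60)%N]).
Proof.
move=> li loE hiE lohi.
pose J (s1 : state R) := exists lo',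
    [/\ (lo <= lo' <= hi)%N /\ wmem s1 2 0 = lo',
        forall k, (lo <= k)%N -> (k < lo')%N -> depth i (item_at s k).2 < 0,
        (rmem s1 17 0, rmem s1 18 0) =
          (if (lo < lo')%N then (item_at s lo'.-1).2 else (rmem s 17 0, rmem s 18 0)),
        (forall a, a != 2%N -> wmem s1 a = wmem s a) &
        (forall a, a \notin [:: 17; 18]%N -> rmem s1 a = rmem s a)].
have neg s1 lo' : J s1 -> wmem s1 2 0 = lo' ->
    reval s1 (depth_cell (wvar 2)) = depth i (item_at s lo').2.
  move=> [lo1 [[_ E1] _ _ fw fr]] E; rewrite /= E !fr //.
  exact: (li (item_at s lo').2).
apply: (@ends_while _ _ _ J (fun s1 => 60 * (hi - wmem s1 2 0))%N).
- by exists lo; rewrite leqnn lohi ltnn; split=> // k lk kl; move: (leq_ltn_trans lk kl); rewrite ltnn.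
- move=> s1 J1; have [lo' [[lo'b E] ng E17 fw fr]] := J1.
  rewrite [beval _ _]/= -[X in _ && (X < _)]/(reval s1 (depth_cell (wvar 2))) (neg _ _ J1 E) E.
  rewrite (fw 3%N) // hiE => /andP[lt dn]; rewrite /block /=.
  apply: ends_setr => ? v; rewrite /= /upd /= E => -> Ev.
  apply: ends_setr => ? v1; rewrite /= /upd /= E => -> Ev1.
  apply: ends_setw => ? v2; rewrite /= /upd /= E => -> Ev2.
  apply: ends_skip; split=> /=; last first.
    by rewrite Ev2; lia.
  exists lo'.+1; rewrite /= Ev2 addn1; split=> //.
  + by split=> //; lia.
  + move=> k lk; rewrite ltnS leq_eqVlt => /predU1P[->//|]; exact: ng.
  + have -> : (lo < lo'.+1)%N by lia.
    by rewrite Ev Ev1 !fr.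
  + move=> a a2; rewrite -fw //; apply/funext => j; by rewrite (negPf a2).
  + move=> a a2; rewrite -fr //; apply/funext => j.
    by move: a2; rewrite !inE => /norP[/negPf -> /negPf ->].
move=> t s' J'; have [lo' [[lo'b E] ng E17 fw fr]] := J'.
rewrite [beval _ _]/= -[X in _ && (X < _)]/(reval s' (depth_cell (wvar 2))) (neg _ _ J' E) E.
rewrite (fw 3%N) // hiE => bf tb; exists lo'; split=> //.
  by move=> lt; move: bf; rewrite lt /= => /negbT; rewrite -leNgt.
by move: tb; rewrite ?E ?loE /=; lia.
Qed.

Lemma pop_back_correct i s lo hi : line i s -> wmem s 3 0 = hi ->
  (lo < hi)%N -> 0 <= depth i (item_at s lo).2 ->
  ends pop_back s (fun t s' => exists hi',
    [/\ (lo < hi' <= hi)%N /\ wmem s' 3 0 = hi',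
        forall k, (hi' <= k)%N -> (k < hi)%N -> depth i (item_at s k).2 < 0,
        0 <= depth i (item_at s hi'.-1).2 &
        (t <= 60 * (hi - hi') + 60)%N]).
Proof.
move=> li hiE lohi d0.
pose J (s1 : state R) := exists hi',
    [/\ (lo < hi' <= hi)%N /\ wmem s1 3 0 = hi',
        forall k, (hi' <= k)%N -> (k < hi)%N -> depth i (item_at s k).2 < 0 &
        rmem s1 = rmem s].
have neg s1 hi' : J s1 -> wmem s1 3 0 = hi' ->
    reval s1 (depth_cell back) = depth i (item_at s hi'.-1).2.
  move=> [lo1 [[_ E1] _ fr]] E; rewrite /= E fr subn1.
  exact: (li (item_at s hi'.-1).2).
apply: (@ends_while _ _ _ J (fun s1 => 60 * wmem s1 3 0)%N).
- by exists hi; rewrite leqnn lohi; split=> // k lk kl; move: (leq_ltn_trans lk kl); rewrite ltnn.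
- move=> s1 J1; have [hi' [[hi'b E] ng fr]] := J1.
  rewrite [beval _ _]/= -[X in (X < _)]/(reval s1 (depth_cell back)) (neg _ _ J1 E) => dn.
  rewrite /block /=.
  apply: ends_setw => ? v2; rewrite /= /upd /= E => -> Ev2.
  have lo1 : (lo < hi'.-1)%N.
    have [E'|] := eqVneq lo hi'.-1; last by lia.
    by move: dn; rewrite -E' ltNge d0.
  apply: ends_skip; split=> /=; last by rewrite Ev2; lia.
  exists hi'.-1; rewrite /= Ev2 subn1; split=> //; first by split=> //; lia.
  move=> k; rewrite leq_eqVlt => /predU1P[<-//|kk]; apply: ng; lia.
move=> t s' J'; have [hi' [[hi'b E] ng fr]] := J'.
rewrite [beval _ _]/= -[X in (X < _)]/(reval s' (depth_cell back)) (neg _ _ J' E) => bf tb.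
exists hi'; split=> //; first by move: bf => /negbT; rewrite -leNgt.
by move: tb; rewrite ?E ?hiE /=; lia.
Qed.

Lemma push_correct i s lo hi a : line i s -> wmem s 0 0 = n -> wmem s 1 0 = i ->
  wmem s 2 0 = lo -> wmem s 3 0 = hi -> (lo < hi)%N -> (rmem s 17 0, rmem s 18 0) = a ->
  ends push s (fun t s' =>
    [/\ wmem s' 2 0 = lo /\ wmem s' 3 0 = hi.+2,
        forall k, (k < hi)%N -> item_at s' k = item_at s k,
        item_at s' hi = ((item_at s hi).1, cut i (item_at s hi.-1).2 (item_at s hi).2),
        item_at s' hi.+1 = ((i + n)%N, cut i a (item_at s lo).2) &
        (t <= 300)%N]).
Proof.
move=> li nE iE loE hiE lohi aE; rewrite /push /block /=.
have bE : (hi - 1 = hi.-1)%N by rewrite subn1.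
have D k : rmem s 13 0 * rmem s 12 k - rmem s 14 0 * rmem s 11 k - rmem s 16 0 =
  depth i (item_at s k).2 := li (item_at s k).2.
have Da : rmem s 13 0 * rmem s 18 0 - rmem s 14 0 * rmem s 17 0 - rmem s 16 0 = depth i a.
  by rewrite -aE; exact: (li (rmem s 17 0, rmem s 18 0)).
have b1 : (hi.-1 == hi) = false by lia.
have b2 : (lo == hi) = false by lia.
have b3 : (hi == hi.+1) = false by lia.
have b4 : (lo == hi.+1) = false by lia.
apply: ends_setr => ? v1; rewrite /= /upd /= hiE bE !D => -> E1.
apply: ends_setr => ? v2; rewrite /= /upd /= hiE bE => -> E2.
apply: ends_setr => ? v3; rewrite /= /upd /= hiE bE => -> E3.
apply: ends_setr => ? v4; rewrite /= /upd /= loE b2 D Da => -> E4.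
apply: ends_setr => ? v5; rewrite /= /upd /= loE hiE addn1 b2 => -> E5.
apply: ends_setr => ? v6; rewrite /= /upd /= loE hiE addn1 b2 => -> E6.
apply: ends_setw => ? v7; rewrite /= /upd /= iE nE hiE addn1 => -> E7.
apply: ends_setw => ? v8; rewrite /= /upd /= hiE addn2 => -> E8.
apply: ends_skip; split=> //=.
- by move=> k kh; rewrite /item_at /= !(ltn_eqF kh) !(ltn_eqF (ltnW (kh : (k.+1 < hi.+1)%N))).
- by rewrite /item_at /= b3 eqxx E2 E3 E1.
- have b5 : (hi.+1 == hi) = false by lia.
  rewrite /item_at /= eqxx E7 E5 E6 E4; move: aE => <-.
  by [].
Qed.

(** The last vertex is loaded first because it is the cyclic predecessor of the front when
    [pop_front] pops nothing. *)
Definition clip_branch : cmd :=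
  CSeq (CSetR 17 (WConst 0) (RGet 11 back)) (CSeq (CSetR 18 (WConst 0) (RGet 12 back))
    (CSeq pop_front (CIf nonempty (CSeq pop_back push) CSkip))).

(** Testing the last vertex suffices, by [last_min]. *)
Definition clip_body : cmd :=
  CSeq set_line (CSeq (CIf (BAnd nonempty (is_neg (depth_cell back))) clip_branch CSkip)
                      (CSeq (incr 1) CSkip)).

Lemma item_at_ext s s' : wmem s' 4 = wmem s 4 -> rmem s' 11 = rmem s 11 ->
  rmem s' 12 = rmem s 12 -> item_at s' = item_at s.
Proof. by move=> h1 h2 h3; apply/funext => k; rewrite /item_at h1 h2 h3. Qed.

Lemma line_ext i s s' : rmem s' 13 = rmem s 13 -> rmem s' 14 = rmem s 14 ->
  rmem s' 16 = rmem s 16 -> line i s -> line i s'.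
Proof. by move=> h1 h2 h3 li x; rewrite h1 h2 h3; exact: li. Qed.

(** Each stored vertex carries a credit of 100. A pop costs at most 60, and the 900 pays for the
    credit of the two new vertices and for all that runs once. *)
Lemma clip_branch_correct i s lo hi : (i < n)%N -> line i s -> wmem s 0 0 = n ->
  wmem s 1 0 = i -> wmem s 2 0 = lo -> wmem s 3 0 = hi -> (lo < hi)%N ->
  clip_inv i (deque s lo hi) -> depth i (item_at s hi.-1).2 < 0 ->
  ends clip_branch s (fun t s' => exists lo' hi',
    [/\ wmem s' 2 0 = lo', wmem s' 3 0 = hi', (lo' <= hi')%N,
        clip_inv i.+1 (deque s' lo' hi') &
        (t + 100 * (hi' - lo') <= 100 * (hi - lo) + 900)%N]).
Proof.
move=> ltin li nE iE loE hiE lohi inv dneg; rewrite /clip_branch.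
have hi0 : (0 < hi)%N by apply: leq_ltn_trans lohi.
apply: ends_setr => ? v1; rewrite /= hiE subn1 => -> E1.
apply: ends_setr => ? v2; rewrite /= /upd /= hiE subn1 => -> E2.
set s1 := State _ _.
have it1 : item_at s1 = item_at s by [].
have li1 : line i s1 by move=> x; exact: li.
apply: ends_seq.
apply: ends_weak (ends_frame (pop_front_correct li1 (loE : wmem s1 2 0 = lo)
  (hiE : wmem s1 3 0 = hi) (ltnW lohi))) _ => t1 s2.
move=> [[lo' [[/andP[l1 l2] lo'E] negA hK E17 tb1]] fw fr].
have it2 : item_at s2 = item_at s.
  by rewrite -it1; apply: item_at_ext; [exact: fw|exact: fr|exact: fr].
rewrite it1 in negA hK E17.
have li2 : line i s2 by apply: line_ext li1; exact: fr.
have hiE2 : wmem s2 3 0 = hi by rewrite fw.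
apply: ends_if; rewrite /= lo'E hiE2; case: ltnP => l3; last first.
  have E : lo' = hi by apply/eqP; rewrite eqn_leq l2 l3.
  apply: ends_skip; exists lo', hi; rewrite E deque_nil; split=> //; last by lia.
    by rewrite lo'E E.
  apply: clip_inv_empty inv _ => u /mem_deque[k [k1 k2 ->]].
  by apply: negA; rewrite ?E.
apply: ends_seq.
have hK2 : 0 <= depth i (item_at s2 lo').2 by rewrite it2; exact: hK.
apply: ends_weak (ends_frame (pop_back_correct li2 hiE2 l3 hK2)) _ => t2 s3.
move=> [[hi' [[/andP[h1 h2] hi'E] negB hL tb2]] fw' fr'].
rewrite it2 in negB hL.
have it3 : item_at s3 = item_at s.
  by rewrite -it2; apply: item_at_ext; [exact: fw'|exact: fr'|exact: fr'].
have li3 : line i s3 by apply: line_ext li2; exact: fr'.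
(* The last vertex had negative depth, so at least one vertex was popped at the back and [b]
   exists. *)
have lt' : (hi' < hi)%N.
  rewrite ltn_neqAle h2 andbT; apply/eqP => E; move: hL; rewrite E.
  by rewrite leNgt dneg.
have nE3 : wmem s3 0 0 = n by rewrite fw' // fw.
have iE3 : wmem s3 1 0 = i by rewrite fw' // fw.
have loE3 : wmem s3 2 0 = lo' by rewrite fw'.
have aE : (rmem s3 17 0, rmem s3 18 0) =
    (if (lo < lo')%N then (item_at s lo'.-1).2 else (item_at s hi.-1).2).
  by rewrite !fr' // E17; case: ifP => // _; rewrite /s1 /= /upd /= E1 E2.
apply: ends_weak (push_correct li3 nE3 iE3 loE3 hi'E h1 aE) _ => t3 s4.
move=> [[lo4 hi4] keep at1 at2 tb3]; rewrite it3 in keep at1 at2.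
exists lo', hi'.+2; split=> //; [lia| |lia].
have dE : deque s4 lo' hi'.+2 = deque s lo' hi' ++
   [:: ((item_at s hi').1, cut i (item_at s hi'.-1).2 (item_at s hi').2);
       ((i + n)%N, cut i (if (lo < lo')%N then (item_at s lo'.-1).2
                          else (item_at s hi.-1).2) (item_at s lo').2)].
  rewrite (@deque_cat s4 lo' hi' hi'.+2); [|lia|lia].
  rewrite (@deque_ext s) => [|k _ kh]; last by rewrite keep.
  by rewrite (@deque_cons s4 hi') // (@deque_cons s4 hi'.+1) // deque_nil at1 at2.
have sE : deque s lo hi = deque s lo lo' ++
   (item_at s lo' :: deque s lo'.+1 hi') ++ item_at s hi' :: deque s hi'.+1 hi.
  rewrite -deque_cons // -deque_cons //.
  rewrite (@deque_cat s lo lo' hi) //; congr cat.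
  by apply: deque_cat => //; exact: ltnW.
have lK : last (item_at s lo') (deque s lo'.+1 hi') = item_at s hi'.-1.
  have -> : last (item_at s lo') (deque s lo'.+1 hi') =
    last (item_at s lo') (deque s lo' hi') by rewrite (@deque_cons s lo' hi').
  exact: last_deque.
have lB : last (item_at s hi') (deque s hi'.+1 hi) = item_at s hi.-1.
  have -> : last (item_at s hi') (deque s hi'.+1 hi) =
    last (item_at s hi') (deque s hi' hi) by rewrite (@deque_cons s hi' hi).
  exact: last_deque.
rewrite dE (@deque_cons s lo') // cat_cons -lK.
have -> : (if (lo < lo')%N then (item_at s lo'.-1).2 else (item_at s hi.-1).2) =
    (last (last (item_at s hi') (deque s hi'.+1 hi)) (deque s lo lo')).2.
  rewrite lB; case: ltnP => ll; first by rewrite last_deque.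
  have -> : lo' = lo by apply/eqP; rewrite eqn_leq l1 ll.
  by rewrite deque_nil.
rewrite sE in inv; apply: clip_inv_cut ltin inv _ _ _ _.
- by move=> u /mem_deque[k [k1 k2 ->]]; exact: negA.
- move=> u; rewrite -deque_cons // => /mem_deque[k [k1 k2 ->]]; exact: negB.
- exact: hK.
- by rewrite lK.
Qed.

Definition clip_state r eps i (s : state R) : Prop :=
  [/\ holds_input r eps s, rmem s 20 0 = delta, (wmem s 2 0 <= wmem s 3 0)%N &
      clip_inv i (deque s (wmem s 2 0) (wmem s 3 0))].

Lemma holds_input_ext r eps s s' : wmem s' 0 = wmem s 0 -> rmem s' 0 = rmem s 0 ->
  rmem s' 1 = rmem s 1 -> rmem s' 2 = rmem s 2 -> holds_input r eps s -> holds_input r eps s'.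
Proof. by move=> h1 h2 h3 h4; rewrite /holds_input h1 h2 h3 h4. Qed.

Lemma clip_body_correct r eps i s : (i < n)%N -> clip_state r eps i s -> wmem s 1 0 = i ->
  ends clip_body s (fun t s' => [/\ clip_state r eps i.+1 s', wmem s' 1 0 = i.+1 &
    (t + 100 * (wmem s' 3 0 - wmem s' 2 0) <= 1100 + 100 * (wmem s 3 0 - wmem s 2 0))%N]).
Proof.
move=> ltin [hi d0 lohi inv] iE; have nE : wmem s 0 0 = n by case: hi.
suff : ends clip_body s (fun t s' =>
    [/\ (wmem s' 2 0 <= wmem s' 3 0)%N,
      clip_inv i.+1 (deque s' (wmem s' 2 0) (wmem s' 3 0)), wmem s' 1 0 = i.+1 &
    (t + 100 * (wmem s' 3 0 - wmem s' 2 0) <= 1100 + 100 * (wmem s 3 0 - wmem s 2 0))%N]).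
  move/ends_frame => H; apply: ends_weak H _ => t s' [[h1 h2 h3 h4] fw fr].
  split=> //; split=> //; last by rewrite fr.
  by apply: holds_input_ext hi; [exact: fw|exact: fr|exact: fr|exact: fr].
rewrite /clip_body; apply: ends_seq.
apply: ends_weak (ends_frame (set_line_correct ltin hi d0 iE)) _ => t1 s1.
move=> [[li tb1] fw fr].
have it1 : item_at s1 = item_at s.
  by apply: item_at_ext; [exact: fw|exact: fr|exact: fr].
have E1 : wmem s1 = wmem s by apply/funext => a; exact: fw.
have inv1 : clip_inv i (deque s1 (wmem s1 2 0) (wmem s1 3 0)).
  by rewrite /deque it1 E1.
apply: ends_seq; apply: ends_if.
have dE : reval s1 (depth_cell back) = depth i (item_at s1 (wmem s1 3 0).-1).2.
  by rewrite /= subn1; exact: (li (item_at s1 (wmem s1 3 0).-1).2).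
rewrite [beval _ _]/= -[X in _ && (X < _)]/(reval s1 (depth_cell back)) dE.
case: ifP => [/andP[ne dn]|skip].
  have := @clip_branch_correct i s1 _ _ ltin li _ _ erefl erefl ne inv1 dn.
  rewrite E1 => /(_ nE iE) /ends_frame H.
  apply: ends_weak H _ => t2 s2 [[lo' [hi' [lo'E hi'E lh inv2 tb2]]] fw2 fr2].
  apply: ends_setw => ? v; rewrite /= => -> Ev; apply: ends_skip.
  rewrite /= /upd /= lo'E hi'E; split=> //; last by move: tb1 tb2; lia.
  by rewrite Ev fw2 // E1 iE addn1.
apply: ends_skip; apply: ends_setw => ? v; rewrite /= => -> Ev; apply: ends_skip.
rewrite /= /upd /= E1; split=> //; last 2 first.
- by rewrite Ev E1 iE addn1.
- by move: tb1; lia.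
rewrite E1 in inv1.
have {}skip : (wmem s 2 0 < wmem s 3 0)%N && (depth i (item_at s1 (wmem s 3 0).-1).2 < 0) = false.
  by move: skip; rewrite E1.
rewrite (@deque_ext s1); last by move=> k _ _; rewrite /item_at /= E1.
move: skip; case: ltnP => [lt|ge] /=.
  move=> /negbT; rewrite -leNgt; move: inv1; rewrite deque_cons // => inv1 dp.
  apply: clip_inv_skip => //.
  have -> : last (item_at s1 (wmem s 2 0)) (deque s1 (wmem s 2 0).+1 (wmem s 3 0)) =
    last (item_at s1 (wmem s 2 0)) (deque s1 (wmem s 2 0) (wmem s 3 0)).
    by rewrite (@deque_cons s1 (wmem s 2 0)).
  by rewrite last_deque.
have E : wmem s 2 0 = wmem s 3 0 by apply/eqP; rewrite eqn_leq lohi ge.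
by rewrite E !deque_nil in inv1 * => _; apply: clip_inv_empty inv1 _.
Qed.

(** * Loading the deque and writing out Pi *)

Definition load_body : cmd :=
  block [:: CSetR 11 (wvar 1) (RGet 1 (WAdd (wvar 1) (WConst 1)));
            CSetR 12 (wvar 1) (RGet 2 (WAdd (wvar 1) (WConst 1)));
            CSetW 4 (wvar 1) (wvar 1); incr 1].

(** Tags increase strictly, so at most one vertex belongs to the current edge and the cursor
    advances at most once per edge. *)
Definition emit_body : cmd :=
  CSeq (CIf (BAnd nonempty (BNot (BLtW (WAdd input_size (wvar 1)) (WGet 4 (wvar 2)))))
         (block [:: CSetR 17 (WConst 0) (RGet 11 (wvar 2));
                    CSetR 18 (WConst 0) (RGet 12 (wvar 2)); incr 2])
         CSkip)
       (block [:: CSetR 9 (wvar 1) (rvar 17); CSetR 10 (wvar 1) (rvar 18); incr 1]).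

Definition emit : cmd :=
  block [:: CSetW 0 (WConst 2) input_size;
            CSetR 17 (WConst 0) (RGet 11 back); CSetR 18 (WConst 0) (RGet 12 back);
            for_each_edge emit_body].

Definition inset_program : cmd :=
  block [:: CSetR 20 (WConst 0) (RSub (RGet 0 (WConst 0)) (RGet 0 (WConst 1)));
            for_each_edge load_body;
            CSetW 2 (WConst 0) (WConst 0); CSetW 3 (WConst 0) input_size;
            for_each_edge clip_body;
            CIf nonempty emit (block [:: CSetW 0 (WConst 2) (WConst 0)])].

Definition emitted (s : state R) : Prop :=
  (wmem s 0 2 = 0%N /\ forall y, ~ inner y) \/
  (wmem s 0 2 = n /\ exists S, [/\ clip_inv n S, S != [::] &
     forall c, (c < n)%N -> (rmem s 9 c, rmem s 10 c) = outv S c]).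

Lemma load_correct r eps s Q : holds_input r eps s ->
  (forall t s', rmem s' 20 = rmem s 20 -> holds_input r eps s' ->
     deque s' 0 n = initial -> (t <= 60 * n + 60)%N -> Q t s') ->
  ends (for_each_edge load_body) s Q.
Proof.
move=> hi HQ; have nE : wmem s 0 0 = n by case: hi.
pose I i s1 := [/\ holds_input r eps s1, rmem s1 20 = rmem s 20 &
  forall k, (k < i)%N -> item_at s1 k = (k, q k.+1)].
apply: (@ends_for _ _ _ n 50 I (fun=> 0%N)) => //=.
- move=> s1 fw fr; split=> //; split=> //; last by rewrite fr.
  by apply: holds_input_ext hi; rewrite ?fw ?fr.
- move=> i s1 ltin [hi1 r20 old] iE _.
  have [x1 y1] := qcell hi1 ltin.
  rewrite /load_body /block /= /wvar.
  apply: ends_setr => ? v1; rewrite /= iE addn1 x1 => -> E1.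
  apply: ends_setr => ? v2; rewrite /= /upd /= iE addn1 y1 => -> E2.
  apply: ends_setw => ? v3; rewrite /= /upd /= iE => -> E3.
  apply: ends_setw => ? v4; rewrite /= /upd /= iE addn1 => -> E4.
  have [? ? ? ?] := hi1.
  apply: ends_skip; split=> //=; split=> //= k; rewrite ltnS leq_eqVlt => /predU1P[->|ki].
    by rewrite /item_at /= !eqxx E1 E2 E3 -surjective_pairing.
  by rewrite -old // /item_at /= !(ltn_eqF ki).
move=> t s' [hi' r20 old] _ tb; apply: HQ => //; last by move: tb; lia.
rewrite /deque subn0; apply/eq_in_map => k; rewrite mem_iota add0n => /andP[_ kn].
exact: old.
Qed.

Lemma tags_increasing s lo hi k1 k2 : sorted ltn (tags (deque s lo hi)) ->
  (lo <= k1)%N -> (k1 < k2)%N -> (k2 < hi)%N -> (wmem s 4 k1 < wmem s 4 k2)%N.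
Proof.
move=> st l1 l12 l2; move: st.
rewrite (@deque_cat s lo k1 hi); [|lia|lia].
rewrite (@deque_cons s k1); last lia.
rewrite /tags map_cat => /cat_sorted2[_] /= /(order_path_min ltn_trans)/allP; apply.
rewrite -map_comp; apply/mapP; exists k2 => //; rewrite mem_iota; lia.
Qed.

Lemma emit_correct r eps s Q : holds_input r eps s -> (wmem s 2 0 < wmem s 3 0)%N ->
  clip_inv n (deque s (wmem s 2 0) (wmem s 3 0)) ->
  (forall t s', holds_input r eps s' -> emitted s' -> (t <= 100 * n + 100)%N -> Q t s') ->
  ends emit s Q.
Proof.
move=> hi; set lo := wmem s 2 0; set hh := wmem s 3 0; set S := deque s lo hh.
move=> lh inv HQ.
have S0 : S != [::] by rewrite /S deque_cons.
have [st _ _ _ _] := inv; have [nE rE eE qE] := hi.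
rewrite /emit /block /=.
apply: ends_setw => ? w0; rewrite /= nE => -> Ew.
apply: ends_setr => ? v1; rewrite /= /upd /= subn1 -/hh => -> E1.
apply: ends_setr => ? v2; rewrite /= /upd /= subn1 -/hh => -> E2.
apply: ends_seq; set s0 := State _ _.
(* The cursor [k] separates the tags below [n + i] from the others. The arrays 17-18 hold the last
   vertex passed, at first the last of the whole list, as the wrap-around of [out] requires. *)
pose I i s1 := exists k,
  [/\ [/\ holds_input r eps s1, wmem s1 0 2 = n, wmem s1 3 0 = hh & item_at s1 = item_at s],
      (lo <= k <= hh)%N /\ wmem s1 2 0 = k,
      (forall j, (lo <= j)%N -> (j < k)%N -> (wmem s 4 j < n + i)%N) /\
      (forall j, (k <= j)%N -> (j < hh)%N -> (n + i <= wmem s 4 j)%N),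
      (rmem s1 17 0, rmem s1 18 0) = (out S (n + i)).2 &
      forall c, (c < i)%N -> (rmem s1 9 c, rmem s1 10 c) = outv S c].
apply: (@ends_for _ _ _ n 70 I (fun=> 0%N)) => //.
- move=> s1 fw fr; split=> //; exists lo; split=> //.
  + split.
    * by rewrite /holds_input fw // fr.
    * by rewrite fw.
    * by rewrite fw.
    * by apply: item_at_ext; rewrite ?fw ?fr.
  + by rewrite leqnn ltnW // fw.
  + split=> [j h1 h2|j h1 h2]; first by move: (leq_ltn_trans h1 h2); rewrite ltnn.
    have jS : item_at s j \in S by apply: map_f; rewrite mem_iota; lia.
    by rewrite addn0; have /andP[] := s_tags inv jS.
  + by rewrite addn0 out_first // fr /S last_deque //= /upd /= E1 E2.
- move=> i s1 ltin [k [[hi1 m1 h3 itE] [/andP[lk kh] kE] [tlo thi] E17 old]] iE n1.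
  pose k' := if (k < hh)%N && ~~ (n + i < wmem s 4 k)%N then k.+1 else k.
  have w4 : wmem s1 4 k = wmem s 4 k by have /(congr1 (fun f => (f k).1)) := itE.
  have stepk : ends (CIf (BAnd nonempty (BNot (BLtW (WAdd input_size (wvar 1)) (WGet 4 (wvar 2)))))
         (block [:: CSetR 17 (WConst 0) (RGet 11 (wvar 2));
                    CSetR 18 (WConst 0) (RGet 12 (wvar 2)); incr 2])
         CSkip) s1 (fun t s2 => [/\ wmem s2 2 0 = k',
           (rmem s2 17 0, rmem s2 18 0) = outv S i & (t <= 40)%N]).
    apply: ends_if; rewrite /= n1 iE kE h3 w4 /k'.
    case: ifP => [/andP[kl tg]|skip].
      rewrite /block /=; apply: ends_setr => ? u1; rewrite /= kE => -> F1.
      apply: ends_setr => ? u2; rewrite /= /upd /= kE => -> F2.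
      apply: ends_setw => ? u3; rewrite /= /upd /= kE addn1 => -> F3.
      apply: ends_skip; split=> //=.
      rewrite /upd /= F1 F2.
      have kS : item_at s k \in S by apply: map_f; rewrite mem_iota; lia.
      have tE : (item_at s k).1 = (n + i)%N.
        by apply/eqP; rewrite /= eqn_leq thi // andbT leqNgt.
      have [oE _] := out_tag inv S0 kS.
      rewrite /outv -tE oE /=.
      by have /(congr1 (fun f => (f k).2)) := itE.
    apply: ends_skip; split=> //.
    rewrite E17 /outv out_notag // => v /mem_deque[j [j1 j2 ->]] /=.
    apply/eqP => jE; move/negbT: skip.
    have [jk|kj] := ltnP j k; first by have := tlo j j1 jk; rewrite jE ltnn.
    have kl : (k < hh)%N := leq_ltn_trans kj j2.
    rewrite kl /= negbK => tk; have [E|kj'] := eqVneq k j; first by move: tk; rewrite E jE ltnn.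
    have := tags_increasing st lk (_ : k < j)%N j2; rewrite ltn_neqAle kj' kj jE => /(_ isT).
    by move=> h; move: (ltn_trans tk h); rewrite ltnn.
  rewrite /emit_body; apply: ends_seq.
  apply: ends_weak (ends_frame stepk) _ => t1 s2 [[kE2 E17' tb1] fw fr].
  rewrite /block /=.
  have iE2 : wmem s2 1 0 = i by rewrite fw.
  apply: ends_setr => ? u1; rewrite /= iE2 => -> F1.
  apply: ends_setr => ? u2; rewrite /= /upd /= iE2 => -> F2.
  apply: ends_setw => ? u3; rewrite /= /upd /= iE2 addn1 => -> F3.
  apply: ends_skip; split => //=; last by move: tb1; lia.
    exists k'; split=> //=.
    + split.
      * apply: (@holds_input_ext _ _ s1) hi1 => //=; [exact: fw|exact: fr|exact: fr|exact: fr].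
      * by rewrite /= fw.
      * by rewrite /= fw.
      * by rewrite -itE; apply: item_at_ext => /=; [exact: fw|exact: fr|exact: fr].
    + by split=> //; rewrite /k'; case: ifP => [/andP[? _]|_]; lia.
    + rewrite /k'; split=> j j1 j2; rewrite addnS.
        move: j2; case: ifP => [/andP[kl tg]|_] j2; last exact/leqW/tlo.
        have [jk|kj] := ltnP j k; first exact/leqW/tlo.
        have -> : j = k by lia.
        by rewrite ltnS leqNgt.
      move: j1; case: ifP => [/andP[kl tg]|/negbT skip] j1.
        exact: leq_ltn_trans (thi k (leqnn k) kl) (tags_increasing st lk j1 j2).
      have kl : (k < hh)%N := leq_ltn_trans j1 j2.
      move: skip; rewrite kl /= negbK => tk.
      have [<-//|kj'] := eqVneq k j.
      apply: ltn_trans tk _; apply: (tags_increasing st) => //.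
      by rewrite ltn_neqAle kj'.
    + by rewrite E17' /outv addnS.
    + move=> c; rewrite ltnS leq_eqVlt => /predU1P[->|ci].
        by rewrite !eqxx F1 F2 E17'.
      by rewrite !(ltn_eqF ci) !fr //; exact: old.
  by rewrite fw // n1.
move=> t s' [k [[hi' m' h3 itE] _ _ _ old]] n' tb.
apply: ends_skip; apply: HQ => //; last by move: tb; rewrite /=; lia.
by right; split=> //; exists S.
Qed.

Lemma inset_program_correct r eps s Q : r - eps = delta -> holds_input r eps s ->
  (forall t s', holds_input r eps s' -> emitted s' -> (t <= 2000 * n + 2000)%N -> Q t s') ->
  ends inset_program s Q.
Proof.
move=> dE hi HQ; have [nE rE eE qE] := hi; rewrite /inset_program /block /=.
apply: ends_setr => ? v; rewrite /= rE eE dE => -> Ev; apply: ends_seq.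
apply: (@load_correct r eps); first by split.
move=> t1 s1 r20 hi1 dq1 tb1; have [n1 _ _ _] := hi1.
apply: ends_setw => ? v1; rewrite /= => -> E1.
apply: ends_setw => ? v2; rewrite /= /upd /= n1 => -> E2.
apply: ends_seq; set s2 := State _ _.
have st2 : clip_state r eps 0 s2.
  split; [by split; [have [] := hi1|have [] := hi1|have [] := hi1|have [] := hi1]| | |].
  - by rewrite /= r20 /upd /= Ev.
  - by rewrite /= E1.
  rewrite /= E1 E2 (@deque_ext s1); last by [].
  by rewrite dq1; exact: clip_inv_initial.
apply: (@ends_for _ _ _ n 1100 (fun i s => clip_state r eps i s)
   (fun s => 100 * (wmem s 3 0 - wmem s 2 0))%N) => //.
- move=> s3 fw fr; rewrite !fw //; split=> //.
  have [hi2 d2 l2 i2] := st2; split; rewrite ?fw ?fr //.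
    by apply: holds_input_ext hi2; rewrite ?fw ?fr.
  by rewrite (@deque_ext s2) // => k _ _; rewrite /item_at fw // fr.
- move=> i s3 ltin st3 iE n3.
  apply: ends_weak (clip_body_correct ltin st3 iE) _ => t s4 [st4 iE4 tb].
  by split=> //; case: st4 => -[].
move=> t3 s3 [hi3 d3 l3 inv3] n3 tb3.
have pE : (100 * (wmem s2 3 0 - wmem s2 2 0) = 100 * n)%N by rewrite /= E1 E2 subn0.
rewrite pE in tb3.
apply: ends_seq; apply: ends_if; rewrite /=; case: ltnP => l.
  apply: (@emit_correct r eps) => // t4 s4 hi4 em4 tb4; apply: ends_skip.
  by apply: HQ => //; move: tb1 tb3 tb4; lia.
apply: ends_setw => ? w; rewrite /= => -> Ew; apply: ends_skip; apply: ends_skip.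
apply: HQ; last by move: tb1 tb3; lia.
  by split; [have [] := hi3|have [] := hi3|have [] := hi3|have [] := hi3].
left; split=> // y iy.
have E : wmem s3 2 0 = wmem s3 3 0 by apply/eqP; rewrite eqn_leq l3 l.
rewrite E deque_nil in inv3; have [_ _ _ _ hs] := inv3.
have /hs /(_ set0) h : region y /\ forall j, (j < n)%N -> 0 <= depth j y.
  exact: (proj1 (innerP y) iy).
by apply: h => [? ? ? _ []|].
Qed.

Lemma polygon0 (v : 'I_0 -> point) : polygon v = set0.
Proof.
apply/seteqP; split=> // x [w [_ + _]].
by rewrite big_ord0 => /esym/eqP; rewrite oner_eq0.
Qed.

Lemma stores_emitted s : emitted s -> stores_polygon s [set y | inner y].
Proof.
(* The number of vertices is a memory cell that occurs in the index type, so it is generalized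
   before it is replaced. *)
have PE m (v : 'I_m -> point) : m = 0%N -> (forall y, ~ inner y) ->
    ccw_vertices v [set y | inner y].
  move=> m0; move: v; rewrite m0 => v ni; split; last by case.
  by rewrite polygon0; apply/seteqP; split=> y // /ni.
have PE' m (v : 'I_m -> point) S : m = n -> clip_inv n S -> S != [::] ->
    (forall i : 'I_m, v i = outv S i) -> ccw_vertices v [set y | inner y].
  move=> mn; move: v; rewrite mn => v inv S0 vE; have -> : v = fun i : 'I_n => outv S i.
    by apply/funext => i; exact: vE.
  split; first by rewrite polygon_outv.
  by move=> i k; rewrite /=; apply: outv_turn.
move=> [[m0 ni]|[mn [S [inv S0 H]]]]; rewrite /stores_polygon; first exact: PE.
by apply: (PE' _ _ S) => // i; rewrite /points; apply: H; rewrite -mn.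
Qed.

(** * The final comparison *)

Definition check_body : cmd :=
  CSeq (CIf (BLtR
    (RMul (RAdd (RGet 0 (WConst 0)) (RGet 0 (WConst 1)))
          (RAdd (RGet 0 (WConst 0)) (RGet 0 (WConst 1))))
    (RAdd (RMul (RSub (RGet 1 (WAdd (wvar 1) (WConst 1))) (RGet 9 (wvar 1)))
                (RSub (RGet 1 (WAdd (wvar 1) (WConst 1))) (RGet 9 (wvar 1))))
          (RMul (RSub (RGet 2 (WAdd (wvar 1) (WConst 1))) (RGet 10 (wvar 1)))
                (RSub (RGet 2 (WAdd (wvar 1) (WConst 1))) (RGet 10 (wvar 1))))))
    (block [:: CSetW 0 (WConst 3) (WConst 0)]) CSkip)
  (block [:: incr 1]).

(** The answer starts as NO when Pi has no vertices and as YES otherwise; the loop, which compares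
    squared distances, can only lower it. *)
Definition check_program : cmd :=
  CSeq (CIf (BLtW (WConst 0) (WGet 0 (WConst 2)))
         (block [:: CSetW 0 (WConst 3) (WConst 1)])
         (block [:: CSetW 0 (WConst 3) (WConst 0)]))
       (for_each_edge check_body).

Lemma check_correct r eps s Q : 0 <= r + eps -> holds_input r eps s ->
  (forall t s', wmem s' 0 3 = ((0 < wmem s 0 2)%N &&
      all (fun c => enorm (q c.+1 - (rmem s 9 c, rmem s 10 c)) <= r + eps) (iota 0 n)) ->
     (t <= 130 * n + 130)%N -> Q t s') ->
  ends check_program s Q.
Proof.
move=> re0 hi HQ; have [nE rE eE qE] := hi; rewrite /check_program.
pose I i (s1 : state R) := [/\ wmem s1 0 0 = n, rmem s1 = rmem s &
  wmem s1 0 3 = ((0 < wmem s 0 2)%N &&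
      all (fun c => enorm (q c.+1 - (rmem s 9 c, rmem s 10 c)) <= r + eps) (iota 0 i))].
have first s1 : I 0%N s1 -> ends (for_each_edge check_body) s1
    (fun t s' => I n s' /\ (t <= 110 * n + 60)%N).
  move=> [n1 r1 m1].
  apply: (@ends_for _ _ _ n 100 I (fun=> 0%N)) => //.
  - by move=> s2 fw fr; split=> //; split; rewrite ?fw ?fr.
  - move=> i s2 ltin [n2 r2 m2] iE _.
    have [x1 y1] := qcell hi ltin.
    rewrite /check_body; apply: ends_seq; apply: ends_if.
    set p := (rmem s 9 i, rmem s 10 i).
    have -> : beval s2 (BLtR
    (RMul (RAdd (RGet 0 (WConst 0)) (RGet 0 (WConst 1)))
          (RAdd (RGet 0 (WConst 0)) (RGet 0 (WConst 1))))
    (RAdd (RMul (RSub (RGet 1 (WAdd (wvar 1) (WConst 1))) (RGet 9 (wvar 1)))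
                (RSub (RGet 1 (WAdd (wvar 1) (WConst 1))) (RGet 9 (wvar 1))))
          (RMul (RSub (RGet 2 (WAdd (wvar 1) (WConst 1))) (RGet 10 (wvar 1)))
                (RSub (RGet 2 (WAdd (wvar 1) (WConst 1))) (RGet 10 (wvar 1)))))) =
      ~~ (enorm (q i.+1 - p) <= r + eps).
      by rewrite /= iE addn1 r2 rE eE x1 y1 enorm_le // -ltNge expr2.
    have allS : all (fun c => enorm (q c.+1 - (rmem s 9 c, rmem s 10 c)) <= r + eps) (iota 0 i.+1) =
       all (fun c => enorm (q c.+1 - (rmem s 9 c, rmem s 10 c)) <= r + eps) (iota 0 i) &&
       (enorm (q i.+1 - p) <= r + eps).
      by rewrite -[in iota 0 i.+1]addn1 iotaD all_cat /= andbT add0n.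
    case E : (_ <= _) => /=.
      apply: ends_skip; apply: ends_setw => ? w; rewrite /= iE addn1 => -> Ew.
      apply: ends_skip; rewrite /I allS E andbT; split=> //=.
    apply: ends_setw => ? w; rewrite /= => -> Ew; apply: ends_skip.
    apply: ends_setw => ? w'; rewrite /= /upd /= iE addn1 => -> Ew'.
    apply: ends_skip; rewrite /I allS E !andbF; split=> //=; by rewrite Ew.
  move=> t s2 I2 _ tb; split=> //; move: tb; lia.
apply: ends_seq; apply: ends_if; rewrite /=; case: ltnP => m2.
  apply: ends_setw => ? w; rewrite /= => -> Ew; apply: ends_skip.
  apply: ends_weak (first _ _) _.
    by split=> //=; rewrite /upd /= Ew m2.
  by move=> t s' [[_ _ h] tb]; apply: HQ => //; move: tb; lia.
apply: ends_setw => ? w; rewrite /= => -> Ew; apply: ends_skip.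
apply: ends_weak (first _ _) _.
  by split=> //=; rewrite /upd /= Ew (leq_gtF m2).
by move=> t s' [[_ _ h] tb]; apply: HQ => //; move: tb; lia.
Qed.

Lemma emitted_answer r eps s : 0 < eps -> eps < r -> r - eps = delta -> emitted s ->
  (0 < wmem s 0 2)%N &&
      all (fun c => enorm (q c.+1 - (rmem s 9 c, rmem s 10 c)) <= r + eps) (iota 0 n) =
  ConvexDecide (fun i : 'I_n => q i) r eps.
Proof.
move=> e0 er dE em; have n0 : (0 < n)%N by lia.
have PiE y : inset (offset region eps) r y <-> inner y.
  rewrite inset_offsetP // dE; split=> H i; have := H i; rewrite /depth; lra.
apply/esym; rewrite /ConvexDecide -/region.
case: em => [[-> ni]|[-> [S [inv S0 H]]]].
  by rewrite /=; apply/asboolP => /(_ (Ordinal n0))[y [_ /PiE/ni]].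
rewrite n0 /=; apply/asboolP/allP => [D c|D i].
  rewrite mem_iota add0n => /andP[_ cn].
  have [y [hy /PiE iy]] := D (Ordinal (ltn_pmod c.+1 n0)).
  rewrite H //; apply: le_trans (outv_nearest inv S0 cn iy) _.
  by move: hy; rewrite /disk /= q_mod -enormN opprB.
(* Point [c] serves [q c.+1], so [q i] is served by its cyclic predecessor; adding [n] first avoids
   the predecessor of 0. *)
pose c := ((i + n).-1 %% n)%N.
have cn : (c < n)%N by rewrite ltn_mod.
have qE : q c.+1 = q i.
  have -> : q c.+1 = q (i + n).-1.+1.
    by apply: (@per_mod _ (fun k => q k.+1)) => k; rewrite -addSn q_per.
  by rewrite prednK ?q_per // addn_gt0 n0 orbT.
exists (outv S c); split; last by apply/PiE; exact: outv_inner.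
have := D c; rewrite mem_iota add0n cn => /(_ isT); rewrite H // qE.
by rewrite /disk /= -enormN opprB.
Qed.

Lemma programs_correct r eps : 0 < eps -> eps < r -> r - eps = delta ->
  runs_ConvexDecide offset_program inset_program check_program
    (fun i : 'I_n => q i) r eps (4000 * n).
Proof.
move=> e0 er dE; rewrite /runs_ConvexDecide -/region.
have PiE : inset (offset region eps) r = [set y | inner y].
  apply/seteqP; split=> y; rewrite inset_offsetP // dE => H i; have := H i;
    rewrite /depth; lra.
set s0 := input _ r eps.
have hq k : (k < n)%N -> (rmem s0 1 k, rmem s0 2 k) = q k.
  by move=> kn; rewrite /s0 /= insubT -surjective_pairing.
have [t1 [s1 [x1 [hi1 so tb1]]]] :=
  @offset_program_correct r eps s0 e0 erefl erefl erefl hq.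
have [t2 [s2 [x2 [hi2 em tb2]]]] : ends inset_program s1
    (fun t s' => [/\ holds_input r eps s', emitted s' & (t <= 2000 * n + 2000)%N]).
  by apply: inset_program_correct dE hi1 _ => t s' h1 h2 h3.
have re0 : 0 <= r + eps by lra.
have [t3 [s3 [x3 [an tb3]]]] : ends check_program s2
    (fun t s' => wmem s' 0 3 = ConvexDecide (fun i : 'I_n => q i) r eps /\
       (t <= 130 * n + 130)%N).
  apply: check_correct re0 hi2 _ => t s' h1 h2; split=> //.
  by rewrite h1 emitted_answer.
exists s1, s2, s3, t1, t2, t3; split=> //.
  by rewrite PiE; split=> //; exact: stores_emitted.
(* The bounds add up to [2330 * (n + 1)], which is at most [4000 * n] because [n] is at least 3. *)
by move: tb1 tb2 tb3 n_ge3; lia.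
Qed.

End Polygon.

(** * From vertices indexed by ['I_n] to a periodic sequence *)

Section CyclicIndices.
Variables (R : realType) (n : nat) (q : 'I_n -> R * R).
Hypothesis q_convex : ccw_convex_polygon q.

Let n_gt0 : (0 < n)%N.
Proof. by case: q_convex => n3 _; apply: ltn_trans n3. Qed.

Definition cyclic k : R * R := q (Ordinal (ltn_pmod k n_gt0)).

Lemma cyclic_ord (i : 'I_n) : cyclic i = q i.
Proof. by congr q; apply: val_inj; rewrite /= modn_small. Qed.

Lemma cyclic_per k : cyclic (k + n) = cyclic k.
Proof. by congr q; apply: val_inj; rewrite /= modnDr. Qed.

Lemma cyclic_convex i k : (2 <= k)%N -> (k < n)%N ->
  0 < orient (cyclic i) (cyclic i.+1) (cyclic (i + k)).
Proof.
move=> k2 kn; have [n3 H] := q_convex.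
have -> : cyclic i.+1 = q (ordS (Ordinal (ltn_pmod i n_gt0))).
  by congr q; apply: val_inj; rewrite /= -addn1 -(addn1 (i %% n)%N) modnDml.
have modE m : (m < n)%N -> ((i + k) %% n = (i + m) %% n)%N -> k = m.
  by move=> mn /eqP; rewrite eqn_modDl !modn_small // => /eqP.
apply: H; apply/eqP => /(congr1 (@nat_of_ord n)) /=.
  by rewrite -[i in RHS]addn0 => /modE h; have := h n_gt0; lia.
rewrite -[(i %% n).+1]addn1 modnDml => /modE h.
by have := h (ltn_trans (isT : 1 < 2)%N n3); lia.
Qed.
End CyclicIndices.

Theorem lemma23 (R : realType) :
  (forall (n : nat) (q : 'I_n -> R * R) (r eps : R),
     ccw_convex_polygon q -> 0 < eps -> eps < r ->
     ConvexDecide q r eps = Decide (polygon q) r eps) /\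
  (exists (p1 p2 p3 : cmd) (C : nat),
     forall (n : nat) (q : 'I_n -> R * R) (r eps : R),
       ccw_convex_polygon q -> 0 < eps -> eps < r ->
       runs_ConvexDecide p1 p2 p3 q r eps (C * n)).
Proof.
split=> [n q r eps _ _ _|]; first exact: ConvexDecideE.
exists offset_program, inset_program, check_program, 4000%N => n q r eps qc e0 er.
have qE : q = (fun i : 'I_n => cyclic qc i) by apply/funext => i; rewrite cyclic_ord.
have [n3 _] := qc.
have d0 : 0 < r - eps by rewrite subr_gt0.
rewrite [q in runs_ConvexDecide _ _ _ q]qE.
exact: (programs_correct n3 (cyclic_per qc) (@cyclic_convex _ _ _ qc) d0 e0 er erefl).
Qed.
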